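(* The \textsc{Paw-free Edge Addition} problem, parameterized by $k$, admits a kernel of size $\mathcal{O}(k^3)$: there is a polynomial-time algorithm that, given an instance $(G,k)$, outputs an equivalent instance $(G',k')$ of the same problem with $k'\le k$ and $G'$ having $\mathcal{O}(k^3)$ vertices.
   Context: The paw is the graph on four vertices $x_1,x_2,x_3,x_4$ with edges $x_1x_2,x_2x_3,x_1x_3,x_3x_4$. A graph is paw-free if it has no induced subgraph isomorphic to the paw. \textsc{Paw-free Edge Addition}: given a graph $G$ and an integer $k$, decide whether there is a set $A$ of at most $k$ unordered pairs of non-adjacent vertices of $G$ such that the graph obtained from $G$ by adding the pairs of $A$ as edges is paw-free. A kernel is a polynomial-time algorithm mapping an instance to an equivalent instance whose size is bounded by a function of $k$ only. *)

(* Defs.v *)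
From mathcomp Require Import all_boot.
Set Implicit Arguments. Unset Strict Implicit. Unset Printing Implicit Defensive.

Definition simple_graph n (E : rel 'I_n) : Prop := symmetric E /\ irreflexive E.

Definition paw_free n (E : rel 'I_n) : Prop :=
  forall x1 x2 x3 x4 : 'I_n, uniq [:: x1; x2; x3; x4] ->
    ~~ [&& E x1 x2, E x2 x3, E x1 x3, E x3 x4, ~~ E x1 x4 & ~~ E x2 x4].

Definition pfea n (E : rel 'I_n) (k : nat) : Prop :=
  exists H : rel 'I_n,
    [/\ simple_graph H, subrel E H, paw_free H &
        #|[set p : 'I_n * 'I_n | [&& (p.1 < p.2)%N, H p.1 p.2 & ~~ E p.1 p.2]]| <= k].

Inductive move := MoveL | MoveR | MoveS.

Record TM := {
  tm_state : finType;
  tm_start : tm_state;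
  tm_halt : pred tm_state;
  tm_delta : tm_state -> option bool -> tm_state * option bool * move }.

(* state, cells left of head (nearest first), scanned cell, cells right of head *)
Definition config (M : TM) :=
  (tm_state M * seq (option bool) * option bool * seq (option bool))%type.

Definition tm_step (M : TM) (c : config M) : config M :=
  let: (q, l, a, r) := c in
  if @tm_halt M q then c else
  let: (q', b, m) := @tm_delta M q a in
  match m with
  | MoveS => (q', l, b, r)
  | MoveL => (q', behead l, head None l, b :: r)
  | MoveR => (q', b :: l, head None r, behead r)
  end.

Definition tm_init (M : TM) (input : seq bool) : config M :=
  let s := map Some input in (@tm_start M, [::], head None s, behead s).

Fixpoint takeSome (s : seq (option bool)) : seq bool :=
  match s with
  | Some b :: s' => b :: takeSome s'
  | _ => [::]
  end.

Definition tm_computes_within (M : TM) (input : seq bool) (t : nat)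
    (output : seq bool) : bool :=
  let: (q, l, a, r) := iter t (@tm_step M) (@tm_init M input) in
  @tm_halt M q && (takeSome (a :: r) == output).

(* binary expansion of k, least significant bit first (k = 0 gives [:: false]) *)
Definition bin (k : nat) : seq bool :=
  [seq odd (k %/ 2 ^ i) | i <- iota 0 (trunc_log 2 k).+1].

Definition enc n (E : rel 'I_n) (k : nat) : seq bool :=
  nseq n true ++ false :: [seq E i j | i <- enum 'I_n, j <- enum 'I_n] ++ bin k.

(* Main.v *)
(** Adding edges between components is useless, and a component without a paw can be dropped.
    In a component with a paw, every completion contains a triangle and is therefore complete
    multipartite.  Call a vertex touched if it lies on an added edge; there are at most 2k
    touched vertices.  If a vertex has more than 2k false twins, one of them is untouched, and
    the vertex can be deleted since it can be reinserted as a copy of that twin.  A vertex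
    whose non-neighbours in its component are its twins can be deleted if its neighbourhood
    contains a triangle having a vertex of the same kind.  Once no rule applies, charging every
    untouched vertex to a touched one shows that a yes-instance has at most 16(k + 1)^2
    vertices; a larger instance is replaced by the paw with k' = 0.

    For the machine, the rules are written as loops over registers with values below the input
    size.  Such a program runs in polynomial time for syntactic reasons, and each of its
    instructions is compiled to a bounded number of sweeps over the tape. *)

Require Import Defs.
From mathcomp Require Import all_boot.
From mathcomp Require Import zify.
From Stdlib Require Import FunctionalExtensionality.
Set Implicit Arguments. Unset Strict Implicit. Unset Printing Implicit Defensive.

(** * Structured Turing machine code *)

(** Completability passes to induced subgraphs, so deleting a vertex never harms a yes-instance; the
    work lies in reinserting the vertex without any new added pair. The graph is not renumbered
    meanwhile: the rules act on a subset [S] of the original vertices, and only the output is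
    relabelled. The constant 16 has this origin: each of the at most 2k touched vertices is charged
    at most 2k + 1 vertices of its own part and 3(2k + 1) vertices of parts without touched
    vertices, and 2k + 2k * 4(2k + 1) = 16k^2 + 10k. The 3 appears because four parts of the latter
    kind would yield the clique that the last rule forbids. On the machine side the obstacle is that
    [k] is written in binary and may be exponential in the input length [N], while a register holds
    only values below [N]. All arithmetic therefore saturates. The only loop of the language tries
    the values from 0 to [N.-1], so a fixpoint has to be reached by a fixed number of rounds instead
    of a stopping condition. *)

Inductive code :=
| CAct of option bool -> option bool * move * bool
| CSeq of code & code
| CIte of code & code & code
| CLoop of code & code.

Fixpoint pos (c : code) : finType :=
  match c with
  | CAct _ => unit
  | CSeq c1 c2 => (pos c1 + pos c2)%type
  | CIte c0 c1 c2 => (pos c0 + (pos c1 + pos c2))%type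
  | CLoop c1 c2 => (pos c1 + pos c2)%type
  end.

Fixpoint start (c : code) : pos c :=
  match c with
  | CAct _ => tt
  | CSeq c1 c2 => inl (start c1)
  | CIte c0 c1 c2 => inl (start c0)
  | CLoop c1 c2 => inl (start c1)
  end.

Definition retarget A B (f : A -> B) (x : A * option bool * move) : B * option bool * move :=
  (f x.1.1, x.1.2, x.2).

(** The exit of a block is redirected, within the same transition, to the start of its successor.
    Gluing blocks thus costs no machine step, and running times simply add up. *)
Fixpoint next (c : code) : pos c -> option bool -> (pos c + bool) * option bool * move :=
  match c with
  | CAct f => fun _ a => let: (w, m, b) := f a in (inr b, w, m)
  | CSeq c1 c2 => fun p a =>
      match p with
      | inl p1 => retarget (fun t => match t with
                    | inl q => inl (inl q) | inr _ => inl (inr (start c2)) end)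
                    (next p1 a)
      | inr p2 => retarget (fun t => match t with
                    | inl q => inl (inr q) | inr b => inr b end) (next p2 a)
      end
  | CIte c0 c1 c2 => fun p a =>
      match p with
      | inl p0 => retarget (fun t => match t with
                    | inl q => inl (inl q)
                    | inr true => inl (inr (inl (start c1)))
                    | inr false => inl (inr (inr (start c2))) end) (next p0 a)
      | inr (inl p1) => retarget (fun t => match t with
                    | inl q => inl (inr (inl q)) | inr b => inr b end) (next p1 a)
      | inr (inr p2) => retarget (fun t => match t with
                    | inl q => inl (inr (inr q)) | inr b => inr b end) (next p2 a)
      end
  | CLoop c1 c2 => fun p a =>
      match p with
      | inl p1 => retarget (fun t => match t with
                    | inl q => inl (inl q)
                    | inr true => inr true
                    | inr false => inl (inr (start c2)) end) (next p1 a)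
      | inr p2 => retarget (fun t => match t with
                    | inl q => inl (inr q)
                    | inr true => inl (inl (start c1))
                    | inr false => inr false end) (next p2 a)
      end
  end.

(* Positions are natural numbers and no code ever moves left of position 0, so the
   left-infinite blank half of the machine's tape need not be represented. *)
Definition tape := ((nat -> option bool) * nat)%type.
Definition upd A (t : nat -> A) p w := fun i => if i == p then w else t i.
Definition shift m p := match m with MoveL => p.-1 | MoveR => p.+1 | MoveS => p end.

Inductive runs : code -> tape -> bool -> tape -> nat -> Prop :=
| runs_act f t p w m b : f (t p) = (w, m, b) -> (m = MoveL -> 0 < p) ->
    runs (CAct f) (t, p) b (upd t p w, shift m p) 1
| runs_seq c1 c2 x y z b b' n n' : runs c1 x b y n -> runs c2 y b' z n' ->
    runs (CSeq c1 c2) x b' z (n + n')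
| runs_ite c0 c1 c2 x y z b b' n n' : runs c0 x b y n ->
    runs (if b then c1 else c2) y b' z n' -> runs (CIte c0 c1 c2) x b' z (n + n')
| runs_loopT c1 c2 x y n : runs c1 x true y n -> runs (CLoop c1 c2) x true y n
| runs_loopF c1 c2 x y z n n' : runs c1 x false y n -> runs c2 y false z n' ->
    runs (CLoop c1 c2) x false z (n + n')
| runs_loopN c1 c2 x y z w b n n' n'' : runs c1 x false y n -> runs c2 y true z n' ->
    runs (CLoop c1 c2) z b w n'' -> runs (CLoop c1 c2) x b w (n + n' + n'').

(** * Simulation of structured code by a Turing machine *)

Section Embedding.
Variable M : TM.

(** A block is usually a piece of a larger machine: [inj] places its positions among the states, and
    [ex] gives the states entered on its two exits. Keeping both general lets the induction of
    [runs_depicts] pass to sub-blocks. *)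
Definition embeds c (inj : pos c -> tm_state M) (ex : bool -> tm_state M) :=
  forall p a, ~~ tm_halt (inj p) /\
    tm_delta (inj p) a =
      retarget (fun t => match t with inl q => inj q | inr b => ex b end) (next p a).

(** Comparison by [nth None] ignores trailing blanks, which the lists of a configuration may or may
    not store. *)
Definition depicts (q : tm_state M) (x : tape) (cfg : config M) :=
  exists l a r, [/\ cfg = (q, l, a, r), a = x.1 x.2,
    forall i, nth None r i = x.1 (x.2 + 1 + i) &
    forall i, nth None l i = if i < x.2 then x.1 (x.2 - 1 - i) else None].

Lemma step_depicts q x cfg q' w m : depicts q x cfg -> ~~ tm_halt q ->
  tm_delta q (x.1 x.2) = (q', w, m) -> (m = MoveL -> 0 < x.2) ->
  depicts q' (upd x.1 x.2 w, shift m x.2) (tm_step cfg).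
Proof.
case: x => t p [l [a [r [-> /= -> Hr Hl]]]] /negbTE hq Hd Hm.
rewrite /tm_step hq Hd; case: m Hd Hm => /= Hd Hm.
- have p0 := Hm erefl.
  exists (behead l), (head None l), (w :: r); split=> //.
  + rewrite -nth0 Hl p0 /upd /=. case: eqP; [lia|]. by rewrite subn0 subn1.
  + case=> [|i]; rewrite /= /upd.
      by rewrite ifT //; lia.
    by rewrite Hr ifF; [congr t|]; lia.
  + move=> i; rewrite nth_behead Hl /= /upd.
    case: (ltnP i.+1 p) => h; last by rewrite ifF //; lia.
    rewrite ifT; last by lia.
    by rewrite ifF; [congr t|]; lia.
- exists (w :: l), (head None r), (behead r); split=> //.
  + rewrite -nth0 Hr /upd /=; case: eqP; [lia|move=> _]; by congr t; lia.
  + by move=> i; rewrite nth_behead Hr /= /upd ifF; [congr t|]; lia.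
  + case=> [|i]; rewrite /= /upd.
      by rewrite ifT //; lia.
    rewrite Hl ltnS; case: ifP => // h.
    by rewrite ifF; [congr t|]; lia.
- exists l, w, r; split=> //.
  + by rewrite /= /upd eqxx.
  + by move=> i; rewrite /= /upd Hr ifF //; lia.
  + by move=> i; rewrite /= /upd Hl; case: ifP => // h; rewrite ifF //; lia.
Qed.

Lemma runs_depicts c x b y n : runs c x b y n -> forall inj ex cfg, @embeds c inj ex ->
  depicts (inj (start c)) x cfg -> depicts (ex b) y (iter n (@tm_step M) cfg).
Proof.
elim=> {c x b y n}.
- move=> f t p w m b Hf Hm inj ex cfg He Hd /=.
  have [h1 h2] := He tt (t p).
  by apply: (step_depicts Hd h1) => //=; rewrite h2 /= Hf.
- move=> c1 c2 x y z b b' n n' _ IH1 _ IH2 inj ex cfg He Hd.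
  rewrite addnC iterD; apply: (IH2 (fun p => inj (inr p))).
    move=> p a; have [h1 h2] := He (inr p) a; split=> //; rewrite h2 /= /retarget /=.
    by case: (next p a) => [[[]]].
  apply: (IH1 (fun p => inj (inl p)) (fun _ => inj (inr (start c2)))) => //.
  move=> p a; have [h1 h2] := He (inl p) a; split=> //; rewrite h2 /= /retarget /=.
  by case: (next p a) => [[[]]].
- move=> c0 c1 c2 x y z b b' n n' _ IH1 _ IH2 inj ex cfg He Hd.
  have He0 : embeds (fun p : pos c0 => inj (inl p)) (fun b => inj (inr
     (if b then inl (start c1) else inr (start c2)))).
    move=> p a; have [h1 h2] := He (inl p) a; split=> //; rewrite h2 /= /retarget /=.
    by case: (next p a) => [[[|[]]]].
  rewrite addnC iterD; have := IH1 _ _ _ He0 Hd.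
  case: b IH1 IH2 => _ IH2.
    apply: (IH2 (fun p => inj (inr (inl p)))).
    move=> p a; have [h1 h2] := He (inr (inl p)) a; split=> //; rewrite h2 /= /retarget /=.
    by case: (next p a) => [[[]]].
  apply: (IH2 (fun p => inj (inr (inr p)))).
  move=> p a; have [h1 h2] := He (inr (inr p)) a; split=> //; rewrite h2 /= /retarget /=.
  by case: (next p a) => [[[]]].
- move=> c1 c2 x y n _ IH inj ex cfg He Hd.
  apply: (IH (fun p => inj (inl p)) (fun b => if b then ex true else inj (inr (start c2)))) => //.
  move=> p a; have [h1 h2] := He (inl p) a; split=> //; rewrite h2 /= /retarget /=.
  by case: (next p a) => [[[|[]]]].
- move=> c1 c2 x y z n n' _ IH1 _ IH2 inj ex cfg He Hd; rewrite addnC iterD.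
  apply: (IH2 (fun p => inj (inr p)) (fun b => if b then inj (inl (start c1)) else ex false)).
    move=> p a; have [h1 h2] := He (inr p) a; split=> //; rewrite h2 /= /retarget /=.
    by case: (next p a) => [[[|[]]]].
  apply: (IH1 (fun p => inj (inl p)) (fun b => if b then ex true else inj (inr (start c2)))) => //.
  move=> p a; have [h1 h2] := He (inl p) a; split=> //; rewrite h2 /= /retarget /=.
  by case: (next p a) => [[[|[]]]].
- move=> c1 c2 x y z w b n n' n'' _ IH1 _ IH2 _ IH3 inj ex cfg He Hd.
  rewrite addnC iterD [n + _]addnC iterD; apply: (IH3 inj ex) => //.
  apply: (IH2 (fun p => inj (inr p)) (fun b => if b then inj (inl (start c1)) else ex false)).
    move=> p a; have [h1 h2] := He (inr p) a; split=> //; rewrite h2 /= /retarget /=.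
    by case: (next p a) => [[[|[]]]].
  apply: (IH1 (fun p => inj (inl p)) (fun b => if b then ex true else inj (inr (start c2)))) => //.
  move=> p a; have [h1 h2] := He (inl p) a; split=> //; rewrite h2 /= /retarget /=.
  by case: (next p a) => [[[|[]]]].
Qed.

End Embedding.

Definition machine (c : code) : TM := {|
  tm_state := (pos c + bool)%type;
  tm_start := inl (start c);
  tm_halt := fun q => if q is inr _ then true else false;
  tm_delta := fun q a => if q is inl p then next p a else (q, a, MoveS) |}.

Lemma embeds_machine c : @embeds (machine c) c inl inr.
Proof. by move=> p a; split=> //=; rewrite /retarget; case: (next p a) => [[[]]]. Qed.

Definition input_tape (s : seq bool) : nat -> option bool :=
  fun i => if i is i'.+1 then nth None (map Some s) i' else None.

Lemma takeSome_nth (s : seq (option bool)) (o : seq bool) :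
  (forall i, i <= size o -> nth None s i = nth None (map Some o) i) -> takeSome s = o.
Proof.
elim: o s => [|b o IH] [|a s] H //=.
- by rewrite (_ : a = None) //; apply: (H 0).
- by have := H 0 isT.
- have -> : a = Some b by apply: (H 0).
  by rewrite IH // => i hi; apply: (H i.+1).
Qed.

Lemma iter_halted (M : TM) (cfg : config M) t :
  tm_halt cfg.1.1.1 -> iter t (@tm_step M) cfg = cfg.
Proof. by case: cfg => [[[q l] a] r] /= h; elim: t => //= t ->; rewrite /tm_step h. Qed.

Lemma machine_computes c s b y n t o :
  runs c (input_tape s, 1) b y n -> n <= t ->
  (forall i, i <= size o -> y.1 (y.2 + i) = nth None (map Some o) i) ->
  tm_computes_within (machine c) s t o.
Proof.
move=> Hr nt Ho.
have Hi : @depicts (machine c) (inl (start c)) (input_tape s, 1) (tm_init (machine c) s).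
  exists [::], (head None (map Some s)), (behead (map Some s)); split=> //=.
  - by move=> i; rewrite nth_behead.
  - by move=> i; rewrite nth_nil; case: ifP => // h; case: i h.
have [l [a [r [E Ea Er _]]]] := runs_depicts Hr (@embeds_machine c) Hi.
rewrite /tm_computes_within -(subnK nt) iterD iter_halted E //=.
apply/eqP; apply: (@takeSome_nth (a :: r)) => -[|i] hi /=.
- by rewrite Ea -Ho // addn0.
- by rewrite Er -Ho //; congr y.1; lia.
Qed.

(** * Time-bounded execution and basic head movements *)

Definition exec c x b y T := exists2 n, n <= T & runs c x b y n.

Lemma exec_le c x b y T T' : exec c x b y T -> T <= T' -> exec c x b y T'.
Proof. by case=> n h r hT; exists n => //; apply: leq_trans hT. Qed.

Lemma exec_act f (t : nat -> option bool) p w m b :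
  f (t p) = (w, m, b) -> (m = MoveL -> 0 < p) ->
  exec (CAct f) (t, p) b (upd t p w, shift m p) 1.
Proof. by move=> h1 h2; exists 1 => //; apply: runs_act. Qed.

Lemma exec_seq c1 c2 x y z b b' n n' : exec c1 x b y n -> exec c2 y b' z n' ->
  exec (CSeq c1 c2) x b' z (n + n').
Proof. by case=> u hu r1 [v hv r2]; exists (u + v); [apply: leq_add | apply: (runs_seq r1 r2)]. Qed.

Lemma exec_ite c0 c1 c2 x y z b b' n n' : exec c0 x b y n ->
  exec (if b then c1 else c2) y b' z n' -> exec (CIte c0 c1 c2) x b' z (n + n').
Proof. by case=> u hu r1 [v hv r2]; exists (u + v); [apply: leq_add | apply: (runs_ite r1 r2)]. Qed.

Lemma exec_loopT c1 c2 x y n : exec c1 x true y n -> exec (CLoop c1 c2) x true y n.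
Proof. by case=> u hu r1; exists u => //; apply: runs_loopT. Qed.

Lemma exec_loopF c1 c2 x y z n n' : exec c1 x false y n -> exec c2 y false z n' ->
  exec (CLoop c1 c2) x false z (n + n').
Proof. by case=> u hu r1 [v hv r2]; exists (u + v); [apply: leq_add | apply: (runs_loopF r1 r2)]. Qed.

Lemma exec_loopN c1 c2 x y z w b n n' n'' :
  exec c1 x false y n -> exec c2 y true z n' -> exec (CLoop c1 c2) z b w n'' ->
  exec (CLoop c1 c2) x b w (n + n' + n'').
Proof.
case=> u hu r1 [v hv r2] [s hs r3]; exists (u + v + s); first by lia.
exact: (runs_loopN r1 r2 r3).
Qed.

Lemma upd_id A (t : nat -> A) p : upd t p (t p) = t.
Proof. by apply: functional_extensionality => i; rewrite /upd; case: eqP => [->|]. Qed.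

Definition cret b := CAct (fun a => (a, MoveS, b)).
Definition cread := CAct (fun a => (a, MoveS, a == Some true)).
Definition cblank := CAct (fun a => (a, MoveS, a == None)).
Definition cwrite w := CAct (fun _ => (w, MoveS, true)).
Definition cright := CAct (fun a => (a, MoveR, true)).
Definition cleft := CAct (fun a => (a, MoveL, true)).
Fixpoint crights n := if n is n'.+1 then CSeq cright (crights n') else cret true.
Fixpoint clefts n := if n is n'.+1 then CSeq cleft (clefts n') else cret true.
Definition cscanR := CLoop cblank cright.
Definition cscanL := CLoop cblank cleft.

Lemma exec_ret b x : exec (cret b) x b x 1.
Proof. by case: x => t p; have := @exec_act (fun a => (a, MoveS, b)) t p _ _ _ erefl; rewrite upd_id; apply. Qed.

Lemma exec_read (t : nat -> option bool) p : exec cread (t, p) (t p == Some true) (t, p) 1.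
Proof. by have := @exec_act (fun a => (a, MoveS, a == Some true)) t p _ _ _ erefl; rewrite upd_id; apply. Qed.

Lemma exec_blank (t : nat -> option bool) p : exec cblank (t, p) (t p == None) (t, p) 1.
Proof. by have := @exec_act (fun a => (a, MoveS, a == None)) t p _ _ _ erefl; rewrite upd_id; apply. Qed.

Lemma exec_write w (t : nat -> option bool) p : exec (cwrite w) (t, p) true (upd t p w, p) 1.
Proof. by apply: (@exec_act _ t p w MoveS true). Qed.

Lemma exec_right (t : nat -> option bool) p : exec cright (t, p) true (t, p.+1) 1.
Proof. by have := @exec_act (fun a => (a, MoveR, true)) t p _ _ _ erefl; rewrite upd_id; apply. Qed.

Lemma exec_left (t : nat -> option bool) p : exec cleft (t, p.+1) true (t, p) 1.
Proof. by have := @exec_act (fun a => (a, MoveL, true)) t p.+1 _ _ _ erefl; rewrite upd_id; apply. Qed.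

Lemma exec_rights n (t : nat -> option bool) p : exec (crights n) (t, p) true (t, p + n) n.+1.
Proof.
elim: n p => [|n IH] p; first by rewrite addn0; apply: exec_ret.
rewrite -addSnnS -[n.+2]add1n; exact: exec_seq (exec_right _ _) (IH _).
Qed.

Lemma exec_lefts n (t : nat -> option bool) p : exec (clefts n) (t, p + n) true (t, p) n.+1.
Proof.
elim: n p => [|n IH] p; first by rewrite addn0; apply: exec_ret.
rewrite addnS -[n.+2]add1n; exact: exec_seq (exec_left _ _) (IH _).
Qed.

Lemma exec_scanR d (t : nat -> option bool) p :
  (forall i, i < d -> t (p + i) != None) -> t (p + d) = None ->
  exec cscanR (t, p) true (t, p + d) (2 * d + 1).
Proof.
elim: d p => [|d IH] p H H0.
  by rewrite addn0 in H0 *; apply: exec_loopT; have := exec_blank t p; rewrite H0.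
rewrite (_ : 2 * d.+1 + 1 = 1 + 1 + (2 * d + 1)); last by lia.
apply: (@exec_loopN _ _ _ (t, p) (t, p.+1)).
- by have := exec_blank t p; have := H 0 isT; rewrite addn0 => /negbTE ->.
- exact: exec_right.
- rewrite -addSnnS; apply: IH; last by rewrite addSnnS.
  by move=> i hi; rewrite addSnnS; apply: H.
Qed.

Lemma exec_scanL d (t : nat -> option bool) p :
  (forall i, i < d -> t (p + i.+1) != None) -> t p = None ->
  exec cscanL (t, p + d) true (t, p) (2 * d + 1).
Proof.
move=> H H0; elim: d H => [|d IH] H.
  by rewrite addn0; apply: exec_loopT; have := exec_blank t p; rewrite H0.
rewrite (_ : 2 * d.+1 + 1 = 1 + 1 + (2 * d + 1)); last by lia.
apply: (@exec_loopN _ _ _ (t, p + d.+1) (t, p + d)).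
- by have := exec_blank t (p + d.+1); have := H d (ltnSn d) => /negbTE ->.
- by rewrite addnS; apply: exec_left.
- by apply: IH => i hi; apply: H; apply: ltnW.
Qed.

(** * The tape as a sequence of records *)

Section Layout.
Variable m : nat.
Hypothesis m_gt0 : 0 < m.

(* The tape after [t] input bits have been consumed: the rest of the input up to position
   [size inp], a blank, [t] records of [m] cells each, a blank, the output. *)
Definition layout (inp : seq bool) (t : nat) (mem : nat -> nat -> bool) (out : seq bool) : nat -> option bool :=
  fun i => if i < (size inp).+2 then (if t < i then input_tape inp i else None)
  else let j := i - (size inp).+2 in
    if j < t * m then Some (mem (j %/ m) (j %% m))
    else if j == t * m then None else nth None (map Some out) (j - (t * m).+1).

Definition setbit (mem : nat -> nat -> bool) r x b :=
  fun r' x' => if (r' == r) && (x' == x) then b else mem r' x'.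

Lemma cell_lt t r x : r < t -> x < m -> r * m + x < t * m.
Proof.
move=> h1 h2; apply: (@leq_trans (r.+1 * m)); first by rewrite mulSn addnC ltn_add2r.
by rewrite leq_mul2r h1 orbT.
Qed.

Lemma layout_cell inp t mem out r x : r < t -> x < m ->
  layout inp t mem out ((size inp).+2 + (r * m + x)) = Some (mem r x).
Proof.
move=> h1 h2; rewrite /layout ltnNge leq_addr /= addKn cell_lt //.
by rewrite divnMDl // divn_small // addn0 modnMDl modn_small.
Qed.

Lemma layout_some inp t mem out j : j < t * m ->
  layout inp t mem out ((size inp).+2 + j) != None.
Proof. by move=> h; rewrite /layout ltnNge leq_addr /= addKn h. Qed.

Lemma layout_end inp t mem out : layout inp t mem out ((size inp).+2 + t * m) = None.
Proof. by rewrite /layout ltnNge leq_addr /= addKn ltnn eqxx. Qed.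

Lemma layout_out inp t mem out i :
  layout inp t mem out ((size inp).+2 + (t * m).+1 + i) = nth None (map Some out) i.
Proof.
rewrite /layout -addnA ltnNge leq_addr /= addKn.
rewrite ifF; last by lia.
by rewrite ifF ?addKn //; lia.
Qed.

Lemma layout_sep inp t mem out : layout inp t mem out (size inp).+1 = None.
Proof.
rewrite /layout ltnSn; case: ifP => // _ /=.
by rewrite nth_default // size_map.
Qed.

Lemma layout_set inp t mem out r x b : r < t -> x < m ->
  upd (layout inp t mem out) ((size inp).+2 + (r * m + x)) (Some b) =
  layout inp t (setbit mem r x b) out.
Proof.
move=> h1 h2; apply: functional_extensionality => i; rewrite /upd /layout.
case: (ltnP i (size inp).+2) => hi.
  by case: eqP => [E|] //; move: hi; rewrite E; lia.
have -> : (i == (size inp).+2 + (r * m + x)) = (i - (size inp).+2 == r * m + x) by lia.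
move: (i - _) => j; case: eqP => [->|ne].
  by rewrite cell_lt // divnMDl // divn_small // addn0 modnMDl modn_small // /setbit !eqxx.
case: ifP => // _; rewrite /setbit; case: eqP => //= E1; case: eqP => //= E2.
by case: ne; rewrite (divn_eq j m) E1 E2.
Qed.

End Layout.

(** * A register language and its compiler *)

(* [Ex x c] resets [x] to 0 when it is done, so that a quantified test leaves the state
   unchanged whenever its bound registers are 0 beforehand. *)
Inductive cmd :=
| Ret of bool
| Bit of nat & nat
| Lt of nat & nat
| Put of nat & nat & bool
| Inc of nat
| Zero of nat
| Emit of bool
| Seq of cmd & cmd
| Ite of cmd & cmd & cmd
| Ex of nat & cmd.

Record state := State { reg : nat -> nat; arr : nat -> nat -> bool; out : seq bool }.

Definition setreg x v s := State (upd (reg s) x v) (arr s) (out s).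
Definition setarr A p b s := State (reg s) (setbit (arr s) A p b) (out s).
Definition emit b s := State (reg s) (arr s) (rcons (out s) b).

Fixpoint sem_ex (f : state -> bool * state) x vs s :=
  if vs is v :: vs' then
    let r := f (setreg x v s) in if r.1 then r else sem_ex f x vs' r.2
  else (false, s).

(** [Inc] saturates at [N.-1] because the machine represents a register by a marker on one of [N]
    records. *)
Fixpoint sem N c s : bool * state :=
  match c with
  | Ret b => (b, s)
  | Bit A x => (arr s A (reg s x), s)
  | Lt x y => (reg s x < reg s y, s)
  | Put A x b => (true, setarr A (reg s x) b s)
  | Inc x => (true, setreg x (minn (reg s x).+1 N.-1) s)
  | Zero x => (true, setreg x 0 s)
  | Emit b => (true, emit b s)
  | Seq c1 c2 => sem N c2 (sem N c1 s).2
  | Ite c0 c1 c2 => let r := sem N c0 s in if r.1 then sem N c1 r.2 else sem N c2 r.2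
  | Ex x c1 => let r := sem_ex (sem N c1) x (iota 0 N) s in (r.1, setreg x 0 r.2)
  end.

Fixpoint writes c : seq nat :=
  match c with
  | Inc x | Zero x => [:: x]
  | Seq c1 c2 => writes c1 ++ writes c2
  | Ite c0 c1 c2 => writes c0 ++ writes c1 ++ writes c2
  | Ex x c1 => x :: writes c1
  | _ => [::]
  end.

Lemma reg_sem N c s x : x \notin writes c -> reg (sem N c s).2 x = reg s x.
Proof.
elim: c s => //=.
- by move=> y s; rewrite inE /upd => /negbTE ->.
- by move=> y s; rewrite inE /upd => /negbTE ->.
- by move=> c1 IH1 c2 IH2 s; rewrite mem_cat negb_or => /andP[h1 h2]; rewrite IH2 // IH1.
- move=> c0 IH0 c1 IH1 c2 IH2 s; rewrite !mem_cat !negb_or => /and3P[h0 h1 h2].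
  by case: (sem N c0 s).1; rewrite ?IH1 ?IH2 // IH0.
- move=> y c IH s; rewrite inE negb_or => /andP[h1 h2].
  rewrite /upd (negbTE h1); elim: (iota 0 N) s => //= v vs IHv s.
  by case: ifP => _; rewrite ?IHv IH //= /upd (negbTE h1).
Qed.

Lemma size_out_sem N c s : size (out s) <= size (out (sem N c s).2).
Proof.
elim: c s => //=.
- by move=> b s; rewrite size_rcons.
- by move=> c1 IH1 c2 IH2 s; apply: leq_trans (IH1 _) (IH2 _).
- move=> c0 IH0 c1 IH1 c2 IH2 s.
  by case: (sem N c0 s).1; [apply: leq_trans (IH0 _) (IH1 _)|apply: leq_trans (IH0 _) (IH2 _)].
- move=> y c IH s; elim: (iota 0 N) s => //= v vs IHv s.
  have := IH (setreg y v s) => /= h.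
  by case: ifP => _ //; apply: leq_trans h (IHv _).
Qed.

Lemma sem_ex_cons f x v vs s : sem_ex f x (v :: vs) s =
  if (f (setreg x v s)).1 then f (setreg x v s) else sem_ex f x vs (f (setreg x v s)).2.
Proof. by []. Qed.

Lemma setreg_setreg x v w s : setreg x v (setreg x w s) = setreg x v s.
Proof.
by rewrite /setreg /=; congr State; apply: functional_extensionality => i; rewrite /upd; case: eqP.
Qed.

Lemma setreg_id x s : setreg x (reg s x) s = s.
Proof. by rewrite /setreg upd_id; case: s. Qed.

Lemma size_out_sem_ex N c x vs s : size (out s) <= size (out (sem_ex (sem N c) x vs s).2).
Proof.
elim: vs s => //= v vs IHv s; have := size_out_sem N c (setreg x v s) => /= h.
by case: ifP => _ //; apply: leq_trans h (IHv _).
Qed.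

(** * Compilation of register commands *)

Section Compiler.
Variables RG AK : nat.
Hypothesis RG_gt0 : 0 < RG.

(** The body of [Ex x] must not write [x]: [sem_ex] assigns the successive values afresh, whereas
    the machine increments the register in place. *)
Fixpoint wfc c : bool :=
  match c with
  | Ret _ | Emit _ => true
  | Bit A x | Put A x _ => (A < AK) && (x < RG)
  | Lt x y => (x < RG) && (y < RG)
  | Inc x | Zero x => x < RG
  | Seq c1 c2 => wfc c1 && wfc c2
  | Ite c0 c1 c2 => [&& wfc c0, wfc c1 & wfc c2]
  | Ex x c1 => [&& x < RG, wfc c1 & x \notin writes c1]
  end.

Let m := RG + AK.

(* The tracks [x < RG] hold the registers in unary, a register of value [v] being a marker
   on record [v]; the other tracks hold the arrays. *)
Definition memory s r x := if x < RG then reg s x == r else arr s (x - RG) r.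

Definition cbit x := CSeq (crights x)
  (CIte cread (CSeq (clefts x) (cret true)) (CSeq (clefts x) (cret false))).
Definition chome := CSeq cscanL cright.
Definition cfind x := CLoop (cbit x) (crights m).
(** The answer has to survive the way home, and only the control can carry it; hence one copy of the
    sweep for each answer. *)
Definition creturn c := CIte c (CSeq chome (cret true)) (CSeq chome (cret false)).
Definition cput A x b := CSeq (cfind x) (CSeq (crights A) (CSeq (cwrite (Some b)) chome)).
(** [cput x x false] uses the register as its own address and so erases the marker on the record
    that carries it. *)
Definition czero x := CSeq (cput x x false) (CSeq (crights x) (CSeq (cwrite (Some true)) chome)).
(** A blank one record further on means that the marker is on the last record, where it stays. *)
Definition cinc x := CSeq (cfind x) (CSeq (crights m) (CIte cblank (CSeq cleft chome)
  (CSeq (clefts m) (CSeq (crights x) (CSeq (cwrite (Some false)) (CSeq (crights m)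
  (CSeq (cwrite (Some true)) chome))))))).
Definition clast x := CSeq (cfind x) (CSeq (crights m)
  (CIte cblank (CSeq cleft (CSeq chome (cret true))) (CSeq cleft (CSeq chome (cret false))))).
(** The search stops at the first record marked for [x] or for [y]; this record lacks the mark of
    [y] exactly when [x] has the smaller value. *)
Definition clt x y := CSeq (CLoop (CIte (cbit x) (cret true) (cbit y)) (crights m))
  (creturn (CIte (cbit y) (cret false) (cret true))).
Definition cemit b := CSeq cscanR (CSeq cright (CSeq cscanR (CSeq (cwrite (Some b))
  (CSeq cscanL (CSeq cleft chome))))).

Fixpoint compile c : code :=
  match c with
  | Ret b => cret b
  | Bit A x => creturn (CSeq (cfind x) (CSeq (crights (RG + A)) cread))
  | Lt x y => clt x y
  | Put A x b => cput (RG + A) x b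
  | Inc x => cinc x
  | Zero x => czero x
  | Emit b => cemit b
  | Seq c1 c2 => CSeq (compile c1) (compile c2)
  | Ite c0 c1 c2 => CIte (compile c0) (compile c1) (compile c2)
  | Ex x c1 => CSeq (czero x)
      (CIte (CLoop (compile c1) (CIte (clast x) (cret false) (cinc x)))
            (CSeq (czero x) (cret true)) (CSeq (czero x) (cret false)))
  end.

Section Correctness.
Variables (inp : seq bool) (Q : nat).
Let N := size inp.
Hypothesis N_gt0 : 0 < N.
Let h := N.+2.
(** [X] bounds the length of the record area and [Q] that of the output; the factor 40 covers every
    primitive command. *)
Let X := N.+1 * m.+1.
Let U := 40 * (X + Q).
Let L s := layout m inp N (memory s) (out s).

Let m_gt0 : 0 < m. Proof. by rewrite /m addn_gt0 RG_gt0. Qed.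
Let m_le : m.+1 <= X. Proof. exact: leq_pmull. Qed.
Let XE : X = N * m + N + m + 1. Proof. by rewrite /X mulSn mulnS; lia. Qed.

Lemma exec_bit (mem : nat -> nat -> bool) o r x : r < N -> x < m ->
  exec (cbit x) (layout m inp N mem o, h + r * m) (mem r x) (layout m inp N mem o, h + r * m) (4 * m.+1).
Proof.
move=> hr hx; apply: (@exec_le _ _ _ _ (x.+1 + (1 + (x.+1 + 1)))); last by lia.
apply: exec_seq (exec_rights _ _ _) _; apply: exec_ite (exec_read _ _) _.
rewrite -addnA layout_cell // (inj_eq Some_inj) addnA eqb_id.
by case: (mem r x); apply: exec_seq (exec_lefts _ _ _) (exec_ret _ _).
Qed.

Lemma exec_home (mem : nat -> nat -> bool) o j : j < N * m ->
  exec chome (layout m inp N mem o, h + j) true (layout m inp N mem o, h) (3 * X).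
Proof.
move=> hj; apply: (@exec_le _ _ _ _ ((2 * j.+1 + 1) + 1)); last by rewrite XE; lia.
apply: exec_seq (exec_right _ _).
rewrite (_ : h + j = N.+1 + j.+1); last by rewrite /h; lia.
apply: exec_scanL; last exact: layout_sep.
by move=> i hi; rewrite -addSnnS layout_some //; lia.
Qed.

Lemma exec_search test (t : nat -> option bool) r0 K :
  (forall r, r <= r0 -> exec test (t, h + r * m) (r == r0) (t, h + r * m) K) ->
  exec (CLoop test (crights m)) (t, h) true (t, h + r0 * m) (r0.+1 * (K + m.+1)).
Proof.
move=> H.
suff G d : d <= r0 -> exec (CLoop test (crights m)) (t, h + (r0 - d) * m) true
    (t, h + r0 * m) (d.+1 * (K + m.+1)).
  by have := G r0 (leqnn _); rewrite subnn mul0n addn0.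
elim: d => [|d IH] hd.
  rewrite subn0 mul1n; apply: exec_loopT; apply: (@exec_le _ _ _ _ K); last exact: leq_addr.
  by have := H r0 (leqnn _); rewrite eqxx.
rewrite mulSn; apply: exec_loopN (IH (ltnW hd)).
  have E : (r0 - d.+1 == r0) = false by lia.
  by have := H (r0 - d.+1) (leq_subr _ _); rewrite E; apply.
have -> : h + (r0 - d) * m = h + (r0 - d.+1) * m + m.
  by rewrite -subSS subSn // mulSn; lia.
exact: exec_rights.
Qed.

Let good s := forall x, x < RG -> reg s x < N.

Lemma memory_reg s r x : x < RG -> memory s r x = (reg s x == r).
Proof. by rewrite /memory => ->. Qed.

Let reg_lt_m x : x < RG -> x < m. Proof. by move=> hx; apply: leq_trans hx _; rewrite leq_addr. Qed.

Lemma exec_find s x : good s -> x < RG ->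
  exec (cfind x) (L s, h) true (L s, h + reg s x * m) (5 * X).
Proof.
move=> gs hx; apply: (@exec_le _ _ _ _ ((reg s x).+1 * (4 * m.+1 + m.+1))); last first.
  rewrite (_ : _ + _ = 5 * m.+1); last by lia.
  by rewrite mulnCA leq_mul2l leq_mul2r (leqW (gs _ hx)) !orbT.
apply: exec_search => r hr; have := @exec_bit (memory s) (out s) r x.
rewrite memory_reg // eq_sym; apply; last exact: reg_lt_m.
exact: leq_ltn_trans hr (gs _ hx).
Qed.

Lemma exec_cput_gen s x A b : good s -> x < RG -> A < m ->
  exec (cput A x b) (L s, h) true
    (layout m inp N (setbit (memory s) (reg s x) A b) (out s), h) (10 * X).
Proof.
move=> gs hx hA; have hr := gs _ hx.
apply: (@exec_le _ _ _ _ (5 * X + (A.+1 + (1 + 3 * X)))); last by rewrite XE; lia.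
apply: exec_seq (exec_find gs hx) _; apply: exec_seq (exec_rights _ _ _) _.
apply: exec_seq (exec_write _ _ _) _.
rewrite -addnA /L layout_set //; apply: exec_home; exact: cell_lt.
Qed.

Lemma memory_setarr s A p b : setbit (memory s) p (RG + A) b = memory (setarr A p b s).
Proof.
apply: functional_extensionality => r; apply: functional_extensionality => x.
rewrite /setbit /memory /setarr /= /setbit; case: (ltnP x RG) => hx.
  by rewrite (_ : x == RG + A = false) ?andbF //; lia.
by rewrite andbC (_ : x == RG + A = (x - RG == A)) //; lia.
Qed.

Lemma memory_setreg s x v : x < RG ->
  setbit (setbit (memory s) (reg s x) x false) v x true = memory (setreg x v s).
Proof.
move=> hx; apply: functional_extensionality => r; apply: functional_extensionality => y.
rewrite /setbit /memory /setreg /= /upd; case: (eqVneq y x) => [->|]; last by rewrite !andbF.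
by rewrite !andbT hx; case: (eqVneq r v) => // _; case: eqVneq.
Qed.

Lemma good_setreg s x v : good s -> v < N -> good (setreg x v s).
Proof. by move=> gs hv y hy; rewrite /= /upd; case: eqP => // _; apply: gs. Qed.

Lemma exec_zero s x : good s -> x < RG ->
  exec (czero x) (L s, h) true (L (setreg x 0 s), h) (16 * X).
Proof.
move=> gs hx; have hm := reg_lt_m hx.
apply: (@exec_le _ _ _ _ (10 * X + (x.+1 + (1 + 3 * X)))); last by rewrite XE; lia.
apply: exec_seq (exec_cput_gen _ gs hx hm) _; apply: exec_seq (exec_rights _ _ _) _.
apply: exec_seq (exec_write _ _ _) _.
have -> : h + x = h + (0 * m + x) by [].
rewrite layout_set // memory_setreg //; apply: exec_home; exact: cell_lt.
Qed.

Let left_end (mem : nat -> nat -> bool) o : exec (CSeq cleft chome) (layout m inp N mem o, h + N * m) true (layout m inp N mem o, h) (1 + 3 * X).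
Proof.
have Nm : 0 < N * m by rewrite muln_gt0 N_gt0.
rewrite -(prednK Nm) addnS; apply: exec_seq (exec_left _ _) _.
by apply: exec_home; rewrite prednK.
Qed.

Lemma exec_last s x : good s -> x < RG ->
  exec (clast x) (L s, h) (reg s x == N.-1) (L s, h) (16 * X).
Proof.
move=> gs hx; have hr := gs _ hx.
apply: (@exec_le _ _ _ _ (5 * X + (m.+1 + (1 + (1 + (3 * X + 1)))))); last by rewrite XE; lia.
apply: exec_seq (exec_find gs hx) _; apply: exec_seq (exec_rights _ _ _) _.
apply: exec_ite (exec_blank _ _) _.
have -> : h + reg s x * m + m = h + (reg s x).+1 * m by rewrite mulSn; lia.
case: (eqVneq (reg s x) N.-1) => E.
  rewrite E prednK // {1}/L layout_end eqxx.
  have Nm : 0 < N * m by rewrite muln_gt0 N_gt0.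
  rewrite -(prednK Nm) addnS; apply: exec_seq (exec_left _ _) _.
  by apply: exec_seq (exec_ret _ _); apply: exec_home; rewrite prednK.
have h1 : (reg s x).+1 < N by lia.
have := cell_lt h1 m_gt0; rewrite addn0 => h2.
rewrite {1}/L (negbTE (layout_some _ _ _ h2)).
have h3 : 0 < (reg s x).+1 * m by rewrite muln_gt0.
rewrite -(prednK h3) addnS; apply: exec_seq (exec_left _ _) _.
by apply: exec_seq (exec_ret _ _); apply: exec_home; rewrite prednK // ltnW.
Qed.

Lemma exec_inc s x : good s -> x < RG ->
  exec (cinc x) (L s, h) true (L (setreg x (minn (reg s x).+1 N.-1) s), h) (20 * X).
Proof.
move=> gs hx; have hr := gs _ hx; have hm := reg_lt_m hx.
case: (eqVneq (reg s x) N.-1) => E.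
  have -> : setreg x (minn (reg s x).+1 N.-1) s = s.
    by rewrite (_ : minn _ _ = reg s x) ?/setreg ?upd_id; [case: s {gs hr E} | lia].
  apply: (@exec_le _ _ _ _ (5 * X + (m.+1 + (1 + (1 + 3 * X))))); last by rewrite XE; lia.
  apply: exec_seq (exec_find gs hx) _; apply: exec_seq (exec_rights _ _ _) _.
  have -> : h + reg s x * m + m = h + N * m by rewrite E -{2}(prednK N_gt0) mulSn; lia.
  by apply: exec_ite (exec_blank _ _) _; rewrite {1}/L layout_end eqxx; apply: left_end.
have h1 : (reg s x).+1 < N by lia.
have -> : minn (reg s x).+1 N.-1 = (reg s x).+1 by lia.
apply: (@exec_le _ _ _ _ (5 * X + (m.+1 + (1 + (m.+1 + (x.+1 + (1 + (m.+1 + (1 + 3 * X)))))))));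
  last by rewrite XE; lia.
apply: exec_seq (exec_find gs hx) _; apply: exec_seq (exec_rights _ _ _) _.
apply: exec_ite (exec_blank _ _) _.
have := cell_lt h1 m_gt0; rewrite addn0 => h2.
have -> : (L s (h + reg s x * m + m) == None) = false.
  have -> : h + reg s x * m + m = h + (reg s x).+1 * m by rewrite mulSn; lia.
  by rewrite {1}/L (negbTE (layout_some _ _ _ h2)).
apply: exec_seq (exec_lefts _ _ _) _; apply: exec_seq (exec_rights _ _ _) _.
apply: exec_seq (exec_write _ _ _) _.
rewrite -addnA /L layout_set // addnA; apply: exec_seq (exec_rights _ _ _) _.
apply: exec_seq (exec_write _ _ _) _.
have -> : h + reg s x * m + x + m = h + ((reg s x).+1 * m + x) by rewrite mulSn; lia.
rewrite layout_set // memory_setreg //; apply: exec_home; exact: cell_lt.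
Qed.

Lemma exec_lt s x y : good s -> x < RG -> y < RG ->
  exec (clt x y) (L s, h) (reg s x < reg s y) (L s, h) (25 * X).
Proof.
move=> gs hx hy; have hrx := gs _ hx; have hry := gs _ hy.
have hmx := reg_lt_m hx; have hmy := reg_lt_m hy.
pose r := minn (reg s x) (reg s y).
have hr : r < N by lia.
apply: (@exec_le _ _ _ _ (r.+1 * (9 * m.+1 + m.+1) + ((4 * m.+1 + 1) + (3 * X + 1)))); last first.
  have : r.+1 * m.+1 <= X by rewrite leq_mul2r ltnS (ltnW hr) orbT.
  by move: m_le; lia.
apply: exec_seq.
  apply: exec_search => i hi.
  have hi' : i < N by apply: leq_ltn_trans hi hr.
  apply: (@exec_le _ _ _ _ (4 * m.+1 + 4 * m.+1)); last by lia.
  apply: exec_ite; first exact: exec_bit.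
  rewrite memory_reg //; case: eqP => E.
    rewrite (_ : i == _); last by lia.
    by apply: exec_le (exec_ret _ _) _.
  rewrite (_ : (i == _) = memory s i y); first exact: exec_bit.
  by rewrite memory_reg //; lia.
have := exec_bit (memory s) (out s) hr hmy; rewrite memory_reg // => H.
apply: (@exec_ite _ _ _ _ (L s, h + r * m) _ (reg s x < reg s y)).
  apply: exec_ite H _; rewrite (_ : reg s y == r = ~~ (reg s x < reg s y)); last by lia.
  by case: ltnP => _; apply: exec_ret.
have := cell_lt hr m_gt0; rewrite addn0 => h2.
by case: ltnP => _; apply: exec_seq (exec_ret _ _); apply: exec_home.
Qed.

Lemma layout_rcons mem o b :
  upd (layout m inp N mem o) (h + (N * m).+1 + size o) (Some b) = layout m inp N mem (rcons o b).
Proof.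
apply: functional_extensionality => i; rewrite /upd.
case: (ltnP i (h + (N * m).+1)) => hi.
  rewrite ifF; last by lia.
  rewrite /layout; case: ifP => // h1; case: ifP => // h2; case: ifP => // h3.
  by move: hi h1 h2 h3; rewrite /h; lia.
rewrite -(subnKC hi) !layout_out // (_ : (_ + _ == _) = (i - (h + (N * m).+1) == size o)); last by lia.
move: (i - _) => j.
rewrite map_rcons nth_rcons size_map.
by case: ltngtP => // hj; rewrite nth_default // size_map ltnW.
Qed.

Lemma exec_emit s b : size (out s) < Q -> exec (cemit b) (L s, h) true (L (emit b s), h) (20 * (X + Q)).
Proof.
move=> hQ.
apply: (@exec_le _ _ _ _ ((2 * (N * m) + 1) + (1 + ((2 * size (out s) + 1) + (1 +
  ((2 * (size (out s)).+1 + 1) + (1 + 3 * X))))))); last by rewrite XE; lia.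
apply: exec_seq.
  apply: (@exec_scanR (N * m)); last exact: layout_end.
  by move=> i; apply: layout_some.
apply: exec_seq (exec_right _ _) _; rewrite -addnS.
apply: exec_seq.
  apply: (@exec_scanR (size (out s))).
    move=> i hi; rewrite /L layout_out // (nth_map false) //.
  by rewrite /L layout_out // nth_default // size_map.
apply: exec_seq (exec_write _ _ _) _; rewrite /L layout_rcons.
apply: (@exec_seq _ _ _ (L (emit b s), h + N * m)).
  have -> : h + (N * m).+1 + size (out s) = h + N * m + (size (out s)).+1 by lia.
  apply: exec_scanL; last exact: layout_end.
  move=> i hi.
  rewrite (_ : _ + i.+1 = h + (N * m).+1 + i); last by lia.
  by rewrite /L layout_out // (nth_map false) // size_rcons.
exact: left_end.
Qed.

Fixpoint cost c : nat :=
  match c with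
  | Seq c1 c2 => cost c1 + cost c2
  | Ite c0 c1 c2 => cost c0 + (cost c1 + cost c2)
  | Ex _ c1 => N * (cost c1 + 2 * U) + 3 * U
  | _ => U
  end.

Let U_ge : 40 * X <= U. Proof. by rewrite /U; lia. Qed.
Let U_gt0 : 0 < U. Proof. by rewrite /U XE; lia. Qed.

(** Output is never erased, so the bound [Q] on the final output also bounds every intermediate one,
    and with it the cost of each [Emit]. *)
Lemma compile_correct c s : wfc c -> good s -> size (out (sem N c s).2) <= Q ->
  good (sem N c s).2 /\
  exec (compile c) (L s, h) (sem N c s).1 (L (sem N c s).2, h) (cost c).
Proof.
elim: c s => /=.
- by move=> b s _ gs _; split=> //; apply: exec_le (exec_ret _ _) _.
- move=> A x s /andP[hA hx] gs _; split=> //; have hr := gs _ hx.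
  have hm : RG + A < m by rewrite ltn_add2l.
  apply: (@exec_le _ _ _ _ (5 * X + ((RG + A).+1 + 1) + (3 * X + 1))); last first.
    by move: m_le U_ge; lia.
  apply: (@exec_ite _ _ _ _ (L s, h + (reg s x * m + (RG + A)))).
    apply: exec_seq (exec_find gs hx) _; apply: exec_seq (exec_rights _ _ _) _.
    have := exec_read (L s) (h + (reg s x * m + (RG + A))).
    have -> : L s (h + (reg s x * m + (RG + A))) = Some (arr s A (reg s x)).
      by rewrite /L layout_cell // /memory ltnNge leq_addr /= addKn.
    by rewrite (inj_eq Some_inj) eqb_id -!addnA; apply.
  by case: (arr _ _ _); apply: exec_seq (exec_ret _ _); apply: exec_home; apply: cell_lt.
- move=> x y s /andP[hx hy] gs _; split=> //.
  by apply: exec_le (exec_lt _ _ _) _ => //; move: U_ge; lia.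
- move=> A x b s /andP[hA hx] gs _; split=> //.
  have hm : RG + A < m by rewrite ltn_add2l.
  rewrite /L -memory_setarr; apply: exec_le (exec_cput_gen _ _ _ _) _ => //.
  by move: U_ge; lia.
- move=> x s hx gs _; split; first by apply: good_setreg => //; lia.
  by apply: exec_le (exec_inc _ _) _ => //; move: U_ge; lia.
- move=> x s hx gs _; split; first exact: good_setreg.
  by apply: exec_le (exec_zero _ _) _ => //; move: U_ge; lia.
- move=> b s _ gs; rewrite size_rcons => hQ; split=> //.
  by apply: exec_le (exec_emit _ _) _ => //; rewrite /U; lia.
- move=> c1 IH1 c2 IH2 s /andP[h1 h2] gs hQ.
  have [g1 e1] := IH1 s h1 gs (leq_trans (size_out_sem _ _ _) hQ).
  have [g2 e2] := IH2 _ h2 g1 hQ.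
  by split=> //; apply: exec_seq e1 e2.
- move=> c0 IH0 c1 IH1 c2 IH2 s /and3P[h0 h1 h2] gs hQ.
  have hQ0 : size (out (sem N c0 s).2) <= Q.
    by move: hQ; case: ifP => _; apply: leq_trans (size_out_sem _ _ _).
  have [g0 e0] := IH0 s h0 gs hQ0.
  case: ifP hQ e0 => _ hQ e0.
    have [g1 e1] := IH1 _ h1 g0 hQ; split=> //.
    by apply: exec_le (exec_ite e0 e1) _; rewrite leq_add2l leq_addr.
  have [g2 e2] := IH2 _ h2 g0 hQ; split=> //.
  by apply: exec_le (exec_ite e0 e2) _; rewrite leq_add2l leq_addl.
- move=> x c IH s /and3P[hx hc hw] gs hQ.
  (* [G] follows the loop from the round in which [d.+1] values are still to be tried; the register
     then holds [N - d.+1]. *)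
  have G d s1 : d < N -> good s1 -> reg s1 x = N - d.+1 ->
      size (out (sem_ex (sem N c) x (iota (N - d.+1) d.+1) s1).2) <= Q ->
      good (sem_ex (sem N c) x (iota (N - d.+1) d.+1) s1).2 /\
      exec (CLoop (compile c) (CIte (clast x) (cret false) (cinc x))) (L s1, h)
        (sem_ex (sem N c) x (iota (N - d.+1) d.+1) s1).1
        (L (sem_ex (sem N c) x (iota (N - d.+1) d.+1) s1).2, h)
        (d.+1 * (cost c + 2 * U)).
    elim: d s1 => [|d IHd] s1 hd g1 E.
      rewrite [iota _ _]/= sem_ex_cons.
      have -> : setreg x (N - 1) s1 = s1 by rewrite -E setreg_id.
      move=> hQ1.
      have [g2 e2] : good (sem N c s1).2 /\ exec (compile c) (L s1, h) (sem N c s1).1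
          (L (sem N c s1).2, h) (cost c).
        by apply: IH => //; move: hQ1; case: ifP.
      case: ifP hQ1 e2 => E1 hQ1 e2; rewrite ?E1.
        by split=> //; apply: exec_le (exec_loopT _ e2) _; rewrite mul1n leq_addr.
      split=> //; rewrite mul1n; apply: exec_loopF e2 _.
      apply: (@exec_le _ _ _ _ (16 * X + 1)); last by move: U_ge U_gt0; lia.
      apply: exec_ite (exec_last g2 hx) _.
      by rewrite reg_sem // E subn1 eqxx; apply: exec_ret.
    have -> : iota (N - d.+2) d.+2 = N - d.+2 :: iota (N - d.+1) d.+1.
      by rewrite -[N - d.+1]subSS subSn.
    rewrite sem_ex_cons.
    have -> : setreg x (N - d.+2) s1 = s1 by rewrite -E setreg_id.
    move=> hQ1.
    have hQ2 : size (out (sem N c s1).2) <= Q.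
      move: hQ1; case: ifP => // _; apply: leq_trans.
      exact: size_out_sem_ex.
    have [g2 e2] := IH s1 hc g1 hQ2.
    case: ifP hQ1 e2 => E1 hQ1 e2; rewrite ?E1.
      split=> //; apply: exec_le (exec_loopT _ e2) _.
      by rewrite mulSn -addnA leq_addr.
    set s2 := (sem N c s1).2 in g2 e2 hQ1 hQ2 *.
    have E2 : reg s2 x = N - d.+2 by rewrite reg_sem.
    have hv : N - d.+1 < N by lia.
    (* Since [sem_ex] sets the register before each round, the increment already made by the machine
       is absorbed. *)
    have h4 : sem_ex (sem N c) x (iota (N - d.+1) d.+1) s2 =
        sem_ex (sem N c) x (iota (N - d.+1) d.+1) (setreg x (N - d.+1) s2).
      by rewrite [iota _ _]/= !sem_ex_cons setreg_setreg.
    rewrite h4 in hQ1 *.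
    have [|g3 e3] := IHd _ (ltnW hd) (good_setreg x g2 hv) _ hQ1.
      by rewrite /= /upd eqxx.
    split=> //; rewrite mulSn.
    apply: exec_loopN e3; first exact: e2.
    apply: (@exec_le _ _ _ _ (16 * X + 20 * X)); last by move: U_ge; lia.
    apply: exec_ite (exec_last g2 hx) _.
    rewrite E2 (_ : N - d.+2 == N.-1 = false); last by lia.
    by have := exec_inc g2 hx; rewrite E2 (_ : minn _ _ = N - d.+1) //; lia.
  have h5 : sem_ex (sem N c) x (iota 0 N) s = sem_ex (sem N c) x (iota 0 N) (setreg x 0 s).
    by rewrite -(prednK N_gt0) [iota _ _]/= !sem_ex_cons setreg_setreg.
  have := G N.-1 (setreg x 0 s); rewrite prednK // subnn -h5 => /(_ (leqnn _) (good_setreg x gs N_gt0)).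
  rewrite /= {1}/upd eqxx => /(_ erefl hQ) [g2 e2]; split; first exact: good_setreg.
  apply: (@exec_le _ _ _ _ (16 * X + (N * (cost c + 2 * U) + (16 * X + 1)))); last first.
    by move: U_ge U_gt0; lia.
  apply: exec_seq (exec_zero gs hx) _; apply: exec_ite e2 _.
  by case: (sem_ex _ _ _ _).1; apply: exec_seq (exec_zero g2 hx) (exec_ret _ _).
Qed.

End Correctness.
End Compiler.

(** * Loading the input into the records *)

Definition initial (inp : seq bool) : state :=
  State (fun _ => 0) (fun A p => (A == 0) && nth false inp p) [::].

Fixpoint cwrites (l : seq bool) : code :=
  if l is b :: l' then CSeq (cwrite (Some b)) (CSeq cright (cwrites l')) else cret true.

Lemma exec_writes l (t : nat -> option bool) p : exec (cwrites l) (t, p) true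
  (fun i => if p <= i < p + size l then Some (nth false l (i - p)) else t i, p + size l) (2 * size l + 1).
Proof.
elim: l t p => [|b l IH] t p /=.
  rewrite addn0 (_ : (fun _ => _) = t); first exact: exec_ret.
  by apply: functional_extensionality => i; rewrite ifF //; lia.
apply: (@exec_le _ _ _ _ (1 + (1 + (2 * size l + 1)))); last by lia.
apply: exec_seq (exec_write _ _ _) _; apply: exec_seq (exec_right _ _) _.
have := IH (upd t p (Some b)) p.+1; rewrite addSnnS.
congr (exec _ _ _ (_, _) _); apply: functional_extensionality => i; rewrite /upd.
case: (ltngtP p i) => [h|h|->] /=; last by rewrite subnn ifT //; lia.
- by case: ifP => // _; rewrite (_ : i - p = (i - p.+1).+1) //; lia.
- by [].
Qed.

Section Loader.
Variables RG AK : nat.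
Hypotheses (RG_gt0 : 0 < RG) (AK_gt0 : 0 < AK).
Let m := RG + AK.

(** All registers start at 0, so the first record bears all their markers and the others bear none;
    track [RG] is array 0, which holds the input. *)
Definition record first b := [seq if x < RG then first else (x == RG) && b | x <- iota 0 (RG + AK)].
(** The blank written over the consumed bit is the mark to which the head returns; the bit itself
    travels in the control, whence the two copies in [cmove]. *)
Definition cappend first b :=
  CSeq (cwrite None) (CSeq cright (CSeq cscanR (CSeq cright (CSeq cscanR
  (CSeq (cwrites (record first b))
  (CSeq cleft (CSeq cscanL (CSeq cleft (CSeq cscanL cright))))))))).
Definition cmove first := CIte cread (cappend first true) (cappend first false).
Definition cload := CSeq (cmove true) (CSeq (CLoop cblank (cmove false)) cright).

Variable inp : seq bool.
Let N := size inp.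
Let X := N.+1 * m.+1.
Let T t := layout m inp t (memory RG (initial inp)) [::].
Let m_gt0 : 0 < m. Proof. by rewrite /m addn_gt0 RG_gt0. Qed.
Let XE : X = N * m + N + m + 1. Proof. by rewrite /X mulSn mulnS; lia. Qed.

Lemma loader_cell t i : t < i -> i < N.+2 -> T t i = nth None (map Some inp) i.-1.
Proof. by move=> h1 h2; rewrite /T /layout h2 h1; case: i h1 h2. Qed.

Lemma loader_cell_some t i : t < i -> i <= N -> T t i != None.
Proof.
move=> h1 h2; rewrite loader_cell //; last by lia.
by rewrite (nth_map false) //; rewrite -/N; lia.
Qed.

Lemma loader_start : input_tape inp = T 0.
Proof.
apply: functional_extensionality => i; rewrite /T /layout mul0n ltn0.
case: ltnP => hi; first by case: i hi.
rewrite nth_nil if_same; case: i hi => //= i hi.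
by rewrite nth_default // size_map; lia.
Qed.

Lemma append_layout t : t < N ->
  (fun i => if N.+2 + t * m <= i < N.+2 + t * m + m
            then Some (nth false (record (t == 0) (nth false inp t)) (i - (N.+2 + t * m)))
            else upd (T t) t.+1 None i) = T t.+1.
Proof.
move=> ht; apply: functional_extensionality => i; rewrite /upd /T /layout -/N.
case: (ltnP i N.+2) => hi.
  rewrite ifF; last by lia.
  case: eqP => [->|ne]; first by rewrite ltnn.
  by rewrite (_ : t.+1 < i = (t < i)) //; lia.
rewrite (_ : (i == t.+1) = false); last by lia.
rewrite -(subnKC hi) leq_add2l -addnA ltn_add2l subnDl addKn; move: (i - _) => j.
rewrite mulSn [m + _]addnC.
case: (ltnP j (t * m)) => h1 /=; first by rewrite (ltn_addr _ h1).
case: (ltnP j (t * m + m)) => h2; last first.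
  by rewrite !nth_nil; case: eqP => //; case: eqP.
have hj : j - t * m < m by lia.
rewrite (nth_map 0) ?size_iota // nth_iota // add0n -(subnKC h1) addKn.
rewrite divnMDl // divn_small // addn0 modnMDl modn_small // /memory /=.
move: (j - _) hj => x hx; congr Some; rewrite [0 == t]eq_sym.
case: ltnP => // hRG; case: (eqVneq x RG) => [->|ne]; first by rewrite subnn.
by rewrite (_ : x - RG == 0 = false) //; lia.
Qed.

Lemma exec_append t : t < N ->
  exec (cappend (t == 0) (nth false inp t)) (T t, t.+1) true (T t.+1, t.+2) (10 * X).
Proof.
move=> ht.
have tm : t.+1 * m <= N * m by rewrite leq_mul2r ht orbT.
have tm' : t * m + m = t.+1 * m by rewrite mulSn addnC.
pose g := upd (T t) t.+1 None.
have gE i : i != t.+1 -> g i = T t i by rewrite /g /upd => /negbTE ->.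
apply: (@exec_le _ _ _ _ (1 + (1 + ((2 * (N - t.+1) + 1) + (1 + ((2 * (t * m) + 1) +
  ((2 * m + 1) + (1 + ((2 * (t.+1 * m) + 1) + (1 + ((2 * (N - t.+1) + 1) + 1)))))))))));
  last by rewrite XE; lia.
apply: exec_seq (exec_write _ _ _) _; rewrite -/g.
apply: exec_seq (exec_right _ _) _.
apply: (@exec_seq _ _ _ (g, N.+1)).
  rewrite (_ : N.+1 = t.+2 + (N - t.+1)); last by lia.
  apply: exec_scanR.
    by move=> i hi; rewrite gE; [apply: loader_cell_some|]; lia.
  rewrite (_ : _ + _ = N.+1); last by lia.
  by rewrite gE; [apply: layout_sep | lia].
apply: exec_seq (exec_right _ _) _.
apply: (@exec_seq _ _ _ (g, N.+2 + t * m)).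
  apply: exec_scanR => [i hi|]; rewrite gE; try by lia.
    exact: layout_some.
  exact: layout_end.
apply: (@exec_seq _ _ _ (T t.+1, N.+1 + (t.+1 * m).+1)).
  have := exec_writes (record (t == 0) (nth false inp t)) g (N.+2 + t * m).
  rewrite !size_map size_iota -/m append_layout //.
  by rewrite (_ : N.+2 + t * m + m = N.+1 + (t.+1 * m).+1); [apply|lia].
rewrite addnS; apply: exec_seq (exec_left _ _) _.
apply: (@exec_seq _ _ _ (T t.+1, N.+1)).
  apply: exec_scanL; last exact: layout_sep.
  by move=> i hi; rewrite -addSnnS; apply: layout_some.
apply: exec_seq (exec_left _ _) _.
apply: exec_seq (exec_right _ _).
rewrite {1}(_ : N = t.+1 + (N - t.+1)); last by lia.
apply: exec_scanL.
  by move=> i hi; apply: loader_cell_some; lia.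
by rewrite /T /layout ltnn; case: ifP => // /negP; rewrite -/N; lia.
Qed.

Lemma exec_move t : t < N -> exec (cmove (t == 0)) (T t, t.+1) true (T t.+1, t.+2) (1 + 10 * X).
Proof.
move=> ht; apply: exec_ite (exec_read _ _) _.
rewrite loader_cell //= ?(nth_map false) //; last by lia.
by rewrite (inj_eq Some_inj) eqb_id; have := exec_append ht; case: (nth false inp t).
Qed.

Lemma exec_load : 0 < N -> exec cload (input_tape inp, 1) true (T N, N.+2) (N * (10 * X + 2) + 2).
Proof.
move=> N0; rewrite loader_start.
have G d : d < N -> exec (CLoop cblank (cmove false)) (T (N - d), (N - d).+1) true (T N, N.+1)
    (d * (10 * X + 2) + 1).
  elim: d => [|d IH] hd.
    rewrite subn0; apply: exec_loopT; have := exec_blank (T N) N.+1.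
    by rewrite /T layout_sep.
  apply: (@exec_le _ _ _ _ (1 + (1 + 10 * X) + (d * (10 * X + 2) + 1))); last by lia.
  apply: exec_loopN (IH (ltnW hd)).
    have := exec_blank (T (N - d.+1)) (N - d.+1).+1.
    by rewrite (_ : _ == None = false); [apply|apply/negbTE; apply: loader_cell_some; lia].
  have ht : N - d.+1 < N by lia.
  have := exec_move ht; rewrite (_ : N - d.+1 == 0 = false); last by lia.
  by rewrite (_ : (N - d.+1).+1 = N - d) //; lia.
apply: (@exec_le _ _ _ _ ((1 + 10 * X) + ((N.-1 * (10 * X + 2) + 1) + 1))); last first.
  by rewrite -{2}(prednK N0) mulSn; lia.
apply: exec_seq (exec_move N0) _; apply: exec_seq (exec_right _ _).
by have := G N.-1; rewrite (_ : N - N.-1 = 1); [apply|]; lia.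
Qed.

End Loader.

(** * Polynomial running time *)

Lemma computes_within_le M inp t t' o :
  tm_computes_within M inp t o -> t <= t' -> tm_computes_within M inp t' o.
Proof.
move=> H /subnK <-; move: H; rewrite /tm_computes_within iterD.
case: (iter t _ _) => [[[q l] a] r] /= /andP[hq hs].
by rewrite iter_halted // hq hs.
Qed.

(** The output is read from the head up to the first blank, so a last sweep carries the head past
    the records. *)
Definition cprogram RG AK c := CSeq (cload RG AK) (CSeq (compile RG AK c) (CSeq cscanR cright)).

Lemma exec_program RG AK c inp Q : 0 < RG -> 0 < AK -> wfc RG AK c -> 0 < size inp ->
  let o := out (sem (size inp) c (initial inp)).2 in size o <= Q ->
  tm_computes_within (machine (cprogram RG AK c)) inp
    ((size inp * (10 * ((size inp).+1 * (RG + AK).+1) + 2) + 2) +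
     (cost RG AK inp Q c + ((2 * (size inp * (RG + AK)) + 1) + 1))) o.
Proof.
move=> RG0 AK0 wc N0 o hQ; set X := _.+1 * _.+1.
have m0 : 0 < RG + AK by rewrite addn_gt0 RG0.
have [_ e2] := @compile_correct RG AK RG0 inp Q N0 c (initial inp) wc (fun _ _ => N0) hQ.
set s := (sem _ _ _).2 in o hQ e2 *.
have [n hn hr] : exec (cprogram RG AK c) (input_tape inp, 1) true
    (layout (RG + AK) inp (size inp) (memory RG s) o, (size inp).+2 + (size inp * (RG + AK)).+1)
    ((size inp * (10 * X + 2) + 2) + (cost RG AK inp Q c + ((2 * (size inp * (RG + AK)) + 1) + 1))).
  apply: exec_seq (exec_load RG0 AK0 N0) _; apply: exec_seq e2 _.
  rewrite addnS; apply: exec_seq (exec_right _ _).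
  apply: exec_scanR; last exact: layout_end.
  by move=> i; apply: layout_some.
apply: machine_computes hr hn _ => i _ /=.
by rewrite layout_out.
Qed.

Fixpoint csize c : nat :=
  match c with
  | Seq c1 c2 => (csize c1 + csize c2).+1
  | Ite c0 c1 c2 => (csize c0 + (csize c1 + csize c2)).+1
  | Ex _ c1 => (csize c1).+1
  | _ => 1
  end.

(** Each constructor multiplies the bound by at most [(size inp).+1 * 5]: a loop makes at most
    [size inp] rounds, and a round with its bookkeeping costs at most three times the bound for the
    body. The exponent depends on the program alone. *)
Lemma cost_le RG AK inp Q c :
  cost RG AK inp Q c <= 40 * ((size inp).+1 * (RG + AK).+1 + Q) * ((size inp).+1 * 5) ^ csize c.
Proof.
set U := 40 * _; set N := size inp; set B := N.+1 * 5.
have B5 : 5 <= B by rewrite /B; lia.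
have B0 : 0 < B by lia.
have leU n : U <= U * B ^ n by rewrite leq_pmulr // expn_gt0 B0.
have mono n k : n <= k -> U * B ^ n <= U * B ^ k by move=> h; rewrite leq_mul2l leq_pexp2l ?orbT.
elim: c => /=; try by move=> *; apply: leU.
- move=> c1 IH1 c2 IH2; rewrite expnS mulnCA.
  have h1 := leq_trans IH1 (mono _ _ (leq_addr (csize c2) (csize c1))).
  have h2 := leq_trans IH2 (mono _ _ (leq_addl (csize c1) (csize c2))).
  by apply: leq_trans (leq_add h1 h2) _; rewrite addnn -mul2n; apply: leq_mul => //; apply: leq_trans B5.
- move=> c0 IH0 c1 IH1 c2 IH2; rewrite expnS mulnCA; set k := csize c0 + _.
  have h0 : cost RG AK inp Q c0 <= U * B ^ k by apply: leq_trans IH0 (mono _ _ _); rewrite /k; lia.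
  have h1 : cost RG AK inp Q c1 <= U * B ^ k by apply: leq_trans IH1 (mono _ _ _); rewrite /k; lia.
  have h2 : cost RG AK inp Q c2 <= U * B ^ k by apply: leq_trans IH2 (mono _ _ _); rewrite /k; lia.
  apply: leq_trans (_ : 3 * (U * B ^ k) <= _); first by lia.
  by apply: leq_mul => //; apply: leq_trans B5.
- move=> x c IH; rewrite -/U -/N expnS [U * (_ * _)]mulnCA.
  have h := leU (csize c); move: h IH; set Y := U * B ^ _ => h IH.
  apply: (@leq_trans (N * (3 * Y) + 3 * Y)); last by rewrite /B; lia.
  by apply: leq_add; [rewrite leq_mul2l; apply/orP; right|]; lia.
Qed.

(** The slack 30 leaves room for the one constant output, the code of the paw with parameter 0,
    which has 4 + 1 + 16 + 1 bits. *)
Theorem program_polytime RG AK c : 0 < RG -> 0 < AK -> wfc RG AK c ->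
  exists K d : nat, forall inp, 0 < size inp ->
    let o := out (sem (size inp) c (initial inp)).2 in size o <= size inp + 30 ->
    tm_computes_within (machine (cprogram RG AK c)) inp (K * size inp ^ d + K) o.
Proof.
move=> RG0 AK0 wc; set e := csize c.
exists (2000 * (RG + AK).+1 * 10 ^ e), (e + 2) => inp N0 o ho.
have H := exec_program RG0 AK0 wc N0 ho.
apply: computes_within_le H _.
apply: leq_trans (leq_addr _ _).
have hc := cost_le RG AK inp (size inp + 30) c; rewrite -/e in hc.
move: (RG + AK) hc => m hc; set N := size inp in N0 hc *.
have hB : (N.+1 * 5) ^ e <= 10 ^ e * N ^ e.
  by rewrite -expnMn; case: (e) => // e'; rewrite leq_exp2r //; lia.
have A1 : 0 < 10 ^ e * N ^ e by rewrite muln_gt0 !expn_gt0 N0.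
have NN : N <= N * N by rewrite leq_pmulr.
have Nm : N <= N * m.+1 by rewrite leq_pmulr.
have mN : m.+1 <= N * m.+1 by rewrite leq_pmull.
have NNm : N * m.+1 <= N * N * m.+1 by rewrite leq_mul2r NN orbT.
(* Expressing every summand in multiples of [N * N * m.+1] gives 40 * (2 + 1 + 30) = 1320; with the
   40 of [h3] the total stays below 2000. *)
have h1 : 40 * (N.+1 * m.+1 + (N + 30)) <= 1320 * (N * N * m.+1) by lia.
have h2 := leq_trans hc (leq_mul h1 hB).
have h3 : N * (10 * (N.+1 * m.+1) + 2) + 2 + (2 * (N * m) + 2) <= 40 * (N * N * m.+1) by lia.
have h4 : 40 * (N * N * m.+1) <= 40 * (N * N * m.+1) * (10 ^ e * N ^ e) by rewrite leq_pmulr.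
have -> : 2000 * m.+1 * 10 ^ e * N ^ (e + 2) = 2000 * (N * N * m.+1) * (10 ^ e * N ^ e).
  by rewrite expnD -mulnn; lia.
by lia.
Qed.

(** * The kernelization rules *)

Section Graphs.
Variable V : finType.
Implicit Types (E H : rel V) (S : {set V}).

Definition paw E x1 x2 x3 x4 :=
  [&& E x1 x2, E x2 x3, E x1 x3, E x3 x4, ~~ E x1 x4 & ~~ E x2 x4].

(** Distinctness is not demanded: in a symmetric irreflexive graph the six conditions imply it. In
    this form pawlessness pulls back along non-injective maps, as the reinsertion of a twin
    requires. *)
Definition pawless E S := forall x1 x2 x3 x4,
  x1 \in S -> x2 \in S -> x3 \in S -> x4 \in S -> ~~ paw E x1 x2 x3 x4.

Definition fill E H S :=
  [set p : V * V | [&& p.1 \in S, p.2 \in S, H p.1 p.2 & ~~ E p.1 p.2]].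

(* [fill] consists of ordered pairs, whence the bound [k.*2]. *)
Definition completable E S k := exists H : rel V,
  [/\ symmetric H, irreflexive H, {in S &, forall x y, E x y -> H x y}, pawless H S
    & #|fill E H S| <= k.*2].

Definition induced E S : rel V := fun x y => [&& x \in S, y \in S & E x y].

(** These are false twins when [E] is irreflexive and [v] lies in [S]: taking [w = v] shows that
    they are not adjacent. *)
Definition twins E S u v := [forall w in S, E u w == E v w].

(* Only vertices at distance at most 2 are inspected, but this suffices: it makes
   the neighbours and twins of [v] a whole connected component of the graph on [S]. *)
Definition dominant E S v :=
  [forall w in S, forall u in S, E v w && E w u ==> E v u || twins E S u v].

Definition twin_excess E S k v := k.*2 < #|[set u in S | (u != v) && twins E S u v]|.

Definition dominated_clique E S v := dominant E S v &&
  [exists a in S, exists b in S, exists c in S,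
    [&& E v a, E v b, E v c, E a b, E a c, E b c & dominant E S a]].

Lemma twinsP E S u v : reflect {in S, forall w, E u w = E v w} (twins E S u v).
Proof. by apply: (iffP forall_inP) => h w /h /eqP. Qed.

Lemma dominantP E S v : reflect (forall w u, w \in S -> u \in S -> E v w -> E w u ->
  E v u || twins E S u v) (dominant E S v).
Proof.
apply: (iffP forall_inP) => [h w u hw hu h1 h2|h w hw].
  by have /forall_inP /(_ u hu) := h w hw; rewrite h1 h2.
by apply/forall_inP => u hu; apply/implyP => /andP[]; apply: h.
Qed.

Lemma completable_sub E S S' k : S' \subset S -> completable E S k -> completable E S' k.
Proof.
move=> /subsetP hS [H [h1 h2 h3 h4 h5]]; exists H; split=> //.
- by move=> x y hx hy; apply: h3; apply: hS.
- by move=> x1 x2 x3 x4 *; apply: h4; apply: hS.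
- apply: leq_trans h5; apply: subset_leq_card; apply/subsetP => p.
  by rewrite !inE => /and4P[/hS -> /hS -> -> ->].
Qed.

(** * Components of paw-free graphs that contain a triangle *)

Section PawFree.
Variables (H : rel V) (S : {set V}).
Hypotheses (Hsym : symmetric H) (HS : pawless H S).

Lemma triangle_adj a b c y : a \in S -> b \in S -> c \in S -> y \in S ->
  H a b -> H a c -> H b c -> H a y -> H b y || H c y.
Proof.
move=> ha hb hc hy ab ac bc ay; have := HS hb hc ha hy.
by rewrite /paw bc [H c a]Hsym ac [H b a]Hsym ab ay /= negb_and !negbK.
Qed.

Lemma connect_induced_in x y : x \in S -> connect (induced H S) x y -> y \in S.
Proof.
move=> hx /connectP[p]; elim: p x hx => [|z p IH] x hx /=; first by move=> _ ->.
by move=> /andP[/and3P[_ hz _]]; apply: IH.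
Qed.

(** Induction along the path: the previous vertex forms a triangle with two of [a], [b], [c], so by
    [triangle_adj] its successor is adjacent to one of these two, and then by [triangle_adj] again
    to a second vertex of the original triangle. *)
Lemma triangle_adj2 a b c y : a \in S -> b \in S -> c \in S ->
  H a b -> H a c -> H b c -> connect (induced H S) a y ->
  [|| H a y && H b y, H a y && H c y | H b y && H c y].
Proof.
move=> ha hb hc ab ac bc /connectP[p pp ->]; move: pp.
have ba : H b a by rewrite Hsym. have ca : H c a by rewrite Hsym.
have cb : H c b by rewrite Hsym.
elim/last_ind: p => [|p z IH]; first by rewrite /= ba ca !orbT.
rewrite rcons_path last_rcons => /andP[/IH]; set x := last a p => hx /and3P[xS zS xz].
have Ta := triangle_adj ha hb hc zS ab ac bc.
have Tb := triangle_adj hb ha hc zS ba bc ac.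
have Tc := triangle_adj hc ha hb zS ca cb ab.
suff : [|| H a z, H b z | H c z].
  case/or3P => h; [move: (Ta h)|move: (Tb h)|move: (Tc h)]; rewrite h /= => /orP[] ->;
  by rewrite ?orbT.
case/or3P: hx => /andP[]; rewrite ![H _ x]Hsym => h1 h2.
- by case/orP: (triangle_adj xS ha hb zS h1 h2 ab xz) => ->; rewrite ?orbT.
- by case/orP: (triangle_adj xS ha hc zS h1 h2 ac xz) => ->; rewrite ?orbT.
- by case/orP: (triangle_adj xS hb hc zS h1 h2 bc xz) => ->; rewrite ?orbT.
Qed.

(** In contrapositive form, non-adjacency is transitive inside the component. Both [x] and [z] see
    two of [a], [b], [c], hence share a neighbour [w]; of the triangle [x], [z], [w] the vertex [y]
    sees two, hence one of [x] and [z]. *)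
Lemma multipartite a b c x y z : a \in S -> b \in S -> c \in S ->
  H a b -> H a c -> H b c ->
  connect (induced H S) a x -> connect (induced H S) a y -> connect (induced H S) a z ->
  H x z -> H x y || H z y.
Proof.
move=> ha hb hc ab ac bc ax ay az xz.
have csym : connect_sym (induced H S).
  by apply: sym_connect_sym => u v; rewrite /induced Hsym andbCA.
have xy : connect (induced H S) x y by apply: connect_trans ay; rewrite csym.
have xS := connect_induced_in ha ax; have zS := connect_induced_in ha az.
have [w wS /andP[wx wz]] : exists2 w, w \in S & H x w && H z w.
  have := triangle_adj2 ha hb hc ab ac bc ax; have := triangle_adj2 ha hb hc ab ac bc az.
  rewrite ![H _ x]Hsym ![H _ z]Hsym.
  have E (u : V) : u \in S -> H x u -> H z u -> exists2 w, w \in S & H x w && H z w.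
    by move=> h1 h2 h3; exists u => //; rewrite h2.
  by case/or3P => /andP[? ?]; case/or3P => /andP[? ?];
    first [exact: (E a) | exact: (E b) | exact: (E c)].
by case/or3P: (triangle_adj2 xS zS wS xz wx wz xy) => /andP[-> _]; rewrite ?orbT.
Qed.

End PawFree.

(** * Soundness of the reduction rules *)

Section Kernel.
Variables (E : rel V) (k : nat).
Hypotheses (Esym : symmetric E) (Eirr : irreflexive E).

(** The completion is kept on [M], the graph is left alone outside, and nothing joins the two sides.
    The vertex [x3] of a paw is adjacent to the other three, so any paw lies on one side. *)
Lemma completable_closed S (M : {set V}) : M \subset S ->
  (forall x y, x \in M -> y \in S -> E x y -> y \in M) ->
  pawless E (S :\: M) -> completable E M k -> completable E S k.
Proof.
move=> /subsetP MS cl nopaw [H [h1 h2 h3 h4 h5]].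
pose H' x y := if (x \in M) && (y \in M) then H x y
  else [&& x \notin M, y \notin M & E x y].
exists H'; split.
- by move=> x y; rewrite /H' h1 Esym; case: (x \in M); case: (y \in M).
- by move=> x; rewrite /H' h2 Eirr !andbF if_same.
- move=> x y xS yS xy; rewrite /H' xy.
  case xM: (x \in M) => /=; first by rewrite (cl _ _ xM yS xy) h3 // (cl _ _ xM yS xy).
  case yM: (y \in M) => //=; move: xy; rewrite Esym => yx.
  by rewrite (cl _ _ yM xS yx) in xM.
- move=> x1 x2 x3 x4 S1 S2 S3 S4; apply/negP; rewrite /paw /H'.
  case M3: (x3 \in M); case M1: (x1 \in M); case M2: (x2 \in M); case M4: (x4 \in M);
    rewrite /= ?andbF //= => hp.
    by have := h4 _ _ _ _ M1 M2 M3 M4; rewrite /paw hp.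
  by have := nopaw x1 x2 x3 x4; rewrite !inE M1 M2 M3 M4 /paw hp => /(_ S1 S2 S3 S4).
- apply: leq_trans h5; apply: subset_leq_card; apply/subsetP => -[x y].
  rewrite !inE /H' /=; case: (x \in M); case: (y \in M); rewrite /= ?andbF //=.
    by case/and4P => _ _ -> ->.
  by case/and4P => _ _ ->.
Qed.

Lemma card_touched H S : #|[set p.1 | p in fill E H S]| <= #|fill E H S|.
Proof. exact: leq_imset_card. Qed.

Lemma untouched H S x y : x \notin [set p.1 | p in fill E H S] -> x \in S -> y \in S ->
  H x y -> E x y.
Proof.
move=> hx xS yS xy; apply/negPn/negP => nE; move/negP: hx; apply.
by apply/imsetP; exists (x, y) => //; rewrite !inE /= xS yS xy.
Qed.

(* An untouched twin [t] of [v] survives, and [v] can be reinserted as a copy of it. *)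
Lemma completable_twin S v : v \in S -> twin_excess E S k v ->
  completable E (S :\ v) k -> completable E S k.
Proof.
rewrite /twin_excess => vS exc [H [h1 h2 h3 h4 h5]].
set T := [set u in S | (u != v) && twins E S u v] in exc.
have [t /andP[tT tn]] : exists t, (t \in T) && (t \notin [set p.1 | p in fill E H (S :\ v)]).
  case: (pickP (fun t => (t \in T) && (t \notin [set p.1 | p in fill E H (S :\ v)]))) => [t|hT].
    by exists t.
  move: exc; rewrite ltnNge => /negP[]; apply: leq_trans h5.
  apply: leq_trans (card_touched _ _); apply: subset_leq_card; apply/subsetP => t tT.
  by have := hT t; rewrite tT => /negbFE.
move: tT; rewrite inE => /and3P[tS tv /twinsP tw].
pose f z := if z == v then t else z.
have fS z : z \in S -> f z \in S :\ v.
  by rewrite /f; case: (eqVneq z v) => [_ _|zv zS]; rewrite !inE ?tv ?tS ?zv.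
exists (fun x y => H (f x) (f y)); split.
- by move=> x y; rewrite h1.
- by move=> x; rewrite h2.
- move=> x y xS yS xy; apply: h3; rewrite ?fS // /f.
  case: (eqVneq x v) xy => [->|_]; case: (eqVneq y v) => [->|_] //.
  + by rewrite Eirr.
  + by rewrite tw.
  + by rewrite Esym => vx; rewrite Esym tw.
- by move=> x1 x2 x3 x4 S1 S2 S3 S4; apply: h4; apply: fS.
- apply: leq_trans h5; apply: subset_leq_card; apply/subsetP => -[x y].
  rewrite !inE /= => /and4P[xS yS hxy nE].
  have tSv : t \in S :\ v by rewrite !inE tv.
  (* No added pair involves [v]: a neighbour in [H] of the untouched [t] is a neighbour of [t] in
     [E], and hence one of its twin [v]. *)
  suff [xv yv] : x != v /\ y != v by rewrite xv yv xS yS nE; move: hxy; rewrite /f (negbTE xv) (negbTE yv) => ->.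
  move: hxy; rewrite /f; case: (eqVneq x v) => [xE|xv]; case: (eqVneq y v) => [yE|yv] //.
  + by rewrite h2.
  + move/(untouched tn tSv); rewrite !inE yv yS => /(_ isT).
    by rewrite tw // -xE (negbTE nE).
  + rewrite h1 => /(untouched tn tSv); rewrite !inE xv xS => /(_ isT).
    by rewrite tw // -yE Esym (negbTE nE).
Qed.

(* The component [C] of [v] is [v]'s part [P] joined to the neighbours of [v]; the
   triangle keeps [C \ P] in a single complete multipartite component. *)
Lemma completable_dominated S v : v \in S -> dominated_clique E S v ->
  completable E (S :\ v) k -> completable E S k.
Proof.
move=> vS /andP[/dominantP dv /existsP[a /andP[aS /existsP[b /andP[bS /existsP[c /andP[cS]]]]]]].
case/and5P => va vb vc ab /and3P[ac bc /dominantP da] [H [h1 h2 h3 h4 h5]].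
pose P x := twins E S x v.
pose C x := (x \in S) && (E v x || P x).
have Pv : P v by apply/twinsP.
have Cv : C v by rewrite /C vS Pv orbT.
have Ccl x y : C x -> y \in S -> E x y -> C y.
  case/andP=> xS /orP[vx|/twinsP tx] yS xy; rewrite /C yS /=; first exact: dv xy.
  by rewrite -tx // xy.
(* Members of [P] have the neighbours of [v], so already in [E] the set [P] is independent and fully
   joined to the rest of [C]. *)
have PE x y : P x -> C y -> E x y = ~~ P y.
  move=> /twinsP tx /andP[yS]; rewrite tx //.
  case: (boolP (P y)) => [/twinsP ty _|_]; last by rewrite orbF => ->.
  by rewrite Esym ty // Eirr.
have inSv x : x \in S -> ~~ P x -> x \in S :\ v.
  by move=> xS; rewrite !inE xS andbT; apply: contra => /eqP ->.
have nbrP x : x \in S -> E v x -> ~~ P x.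
  by move=> xS vx; rewrite -(PE v x Pv) // /C xS vx.
(* Edges of [H] between [C] and the outside are dropped, and pairs meeting [P] revert to [E]. Every
   pair that [H'] adds was thus added by [H] and avoids [v]. *)
pose H' x y := if C x && C y then (if P x || P y then E x y else H x y)
  else [&& ~~ C x, ~~ C y & H x y].
exists H'; split.
- by move=> x y; rewrite /H' h1 Esym [P x || _]orbC [C x && _]andbC; case: (C x); case: (C y).
- by move=> x; rewrite /H' h2 Eirr !andbF !if_same.
- move=> x y xS yS xy; rewrite /H'.
  case Cx: (C x); case Cy: (C y) => /=.
  + case: ifP => //; move/negbT; rewrite negb_or => /andP[Px Py].
    by apply: h3; rewrite ?inSv.
  + by rewrite (Ccl _ _ Cx yS xy) in Cy.
  + by move: xy; rewrite Esym => yx; rewrite (Ccl _ _ Cy xS yx) in Cx.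
  + apply: h3 => //; rewrite !inE ?xS ?yS andbT; apply/eqP => xv.
      by rewrite xv Cv in Cx.
    by rewrite xv Cv in Cy.
- move=> x1 x2 x3 x4 S1 S2 S3 S4; apply/negP; rewrite /paw.
  case C3: (C x3).
    have nbr x : H' x x3 -> C x by rewrite /H' C3 andbT; case: (C x).
    have nbr' x : H' x3 x -> C x by rewrite /H' C3 /=; case: (C x).
    case/and5P => e12 /nbr C2 /nbr C1 /nbr' C4.
    move: e12; rewrite /H' C1 C2 C4 /=.
    (* Within [C] a vertex of [P] misses only vertices of [P], so [x1] and [x2] would be adjacent
       members of the independent set [P]. *)
    case P4: (P x4).
      rewrite !orbT /= [E x1 x4]Esym [E x2 x4]Esym (PE x4 x1) // (PE x4 x2) // !negbK => e12 /andP[p1 p2].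
      by move: e12; rewrite p1 (PE x1 x2) // p2.
    rewrite !orbF; case P1: (P x1); first by rewrite [E x1 x4]PE // P4.
    case P2: (P x2); first by rewrite [E x2 x4]PE // P4 andbF.
    rewrite /= => e12 /andP[n1 n2].
    have sub x : C x -> ~~ P x -> (x \in S) && E v x.
      by case/andP=> xS; rewrite xS => /orP[//|->].
    have aSv := inSv _ aS (nbrP _ aS va); have bSv := inSv _ bS (nbrP _ bS vb).
    have cSv := inSv _ cS (nbrP _ cS vc).
    (* A path to [a] must avoid the deleted [v]. A neighbour [x] of [v] is at distance at most 2
       from the dominant vertex [a], so it is either adjacent to [a] or a twin of [a], and in the
       second case adjacent to [b]. *)
    have cn x : C x -> ~~ P x -> connect (induced H (S :\ v)) a x.
      move=> Cx Px; have /andP[xS vx] := sub x Cx Px; have xSv := inSv _ xS Px.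
      have av : E a v by rewrite Esym.
      case/orP: (da _ _ vS xS av vx) => [ax|/twinsP tx].
        by apply: connect1; rewrite /induced aSv xSv h3.
      apply: connect_trans (connect1 (_ : induced H (S :\ v) a b)) (connect1 _).
        by rewrite /induced aSv bSv h3.
      by rewrite /induced bSv xSv h3 // Esym tx.
    have := multipartite h1 h4 aSv bSv cSv (h3 _ _ aSv bSv ab) (h3 _ _ aSv cSv ac)
      (h3 _ _ bSv cSv bc) (cn _ C1 (negbT P1)) (cn _ C4 (negbT P4)) (cn _ C2 (negbT P2)) e12.
    by rewrite (negbTE n1) (negbTE n2).
  have nbr x : H' x x3 -> ~~ C x by rewrite /H' C3 andbF; case: (C x).
  have nbr' x : H' x3 x -> ~~ C x by rewrite /H' C3 /=; case: (C x).
  case/and5P => e12 e23 e13 e34.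
  have C1 := nbr _ e13; have C2 := nbr _ e23; have C4 := nbr' _ e34.
  move: e12 e23 e13 e34; rewrite /H' (negbTE C1) (negbTE C2) C3 (negbTE C4) /=.
  move=> e12 e23 e13 e34 /andP[n1 n2].
  have inS x : x \in S -> ~~ C x -> x \in S :\ v.
    by move=> xS nC; rewrite !inE xS andbT; apply: contraNneq nC => ->.
  have := h4 _ _ _ _ (inS _ S1 C1) (inS _ S2 C2) (inS _ S3 (negbT C3)) (inS _ S4 C4).
  by rewrite /paw e12 e23 e13 e34 n1 n2.
- apply: leq_trans h5; apply: subset_leq_card; apply/subsetP => -[x y].
  rewrite !inE /= /H' => /and4P[xS yS].
  case Cx: (C x); case Cy: (C y); rewrite //= => hxy nE.
    move: hxy; case: ifP; first by rewrite (negbTE nE).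
    move/negbT; rewrite negb_or => /andP[Px Py] hxy.
    have := inSv _ xS Px; have := inSv _ yS Py; rewrite !inE => -> ->.
    by rewrite hxy nE.
  rewrite xS yS hxy nE !andbT; apply/andP; split; apply/eqP => xv.
    by rewrite xv Cv in Cx.
  by rewrite xv Cv in Cy.
Qed.

(** * Size of a reduced yes-instance *)

Section Bound.
Variable S : {set V}.
Hypothesis reach : forall v, v \in S -> exists x1 x2 x3 x4,
  [/\ x2 \in S, x3 \in S, x4 \in S, paw E x1 x2 x3 x4 & connect (induced E S) v x1].
Hypothesis no_excess : forall v, v \in S -> ~~ twin_excess E S k v.
Hypothesis no_dominated : forall v, v \in S -> ~~ dominated_clique E S v.

(* A vertex outside the set [T] of touched vertices is charged to a touched vertex of its own
   part (at most [2k + 1] times), or else to a touched vertex of its component; the vertices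
   of the second kind fill at most 3 parts of the component. *)
Lemma kernel_bound : completable E S k -> #|S| <= 16 * k.+1 ^ 2.
Proof.
case=> H [h1 h2 h3 h4 h5].
set T := [set p.1 | p in fill E H S].
have cT : #|T| <= k.*2 by apply: leq_trans (card_touched _ _) h5.
have TS t : t \in T -> t \in S by case/imsetP=> -[x y]; rewrite inE => /and4P[h _ _ _] ->.
have HE u w : u \in S :\: T -> w \in S -> H u w = E u w.
  rewrite inE => /andP[uT uS] wS; apply/idP/idP; last exact: h3.
  exact: untouched uT uS wS.
pose Hc := connect (induced H S).
have csym : connect_sym (induced H S).
  by apply: sym_connect_sym => u v; rewrite /induced h1 andbCA.
have ES x y : connect (induced E S) x y -> Hc x y.
  apply: connect_sub => {}x {}y /and3P[xS yS xy]; apply: connect1.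
  by rewrite /induced xS yS h3.
(* [H] keeps the edges of the paw reached from [v], so it has to join the pendant [x4] to [x1] or
   [x2]. Hence [x4] is touched, and [x1], [x2], [x3] form a triangle of [H]. *)
have comp v : v \in S -> exists a b c, [/\ a \in S, b \in S & c \in S] /\
    [/\ H a b, H a c, H b c, Hc a v & exists2 t, t \in T & Hc v t].
  move=> vS; have [x1 [x2 [x3 [x4 [S2 S3 S4 pw /ES vx]]]]] := reach vS.
  have S1 := connect_induced_in vS vx.
  case/and5P: pw => e12 e23 e13 e34 /andP[n14 n24].
  exists x1, x2, x3; split=> //; split; try by apply: h3.
    by rewrite /Hc csym.
  exists x4; last first.
    apply: connect_trans vx _; apply: connect_trans (connect1 (_ : induced H S x1 x3)) (connect1 _);
    by rewrite /induced ?S1 ?S3 ?S4 h3.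
  have := h4 _ _ _ _ S1 S2 S3 S4; rewrite /paw (h3 x1 x2) // (h3 x2 x3) // (h3 x1 x3) // (h3 x3 x4) //= negb_and !negbK.
  case/orP=> hx.
    by apply/imsetP; exists (x4, x1); rewrite // !inE /= S4 S1 h1 hx Esym n14.
  by apply/imsetP; exists (x4, x2); rewrite // !inE /= S4 S2 h1 hx Esym n24.
(* [R] relates the vertices of one part of a component of [H]; its transitivity is
   [multipartite]. *)
pose R x y := Hc x y && ~~ H x y.
have Rsym x y : R x y = R y x by rewrite /R /Hc csym h1.
have Rtrans x y z : x \in S -> R x y -> R y z -> R x z.
  move=> xS /andP[xy nxy] /andP[yz nyz]; rewrite /R /Hc (connect_trans xy yz) /=.
  apply/negP => xz; have [a [b [c [[aS bS cS] [ab ac bc ax _]]]]] := comp x xS.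
  have ay := connect_trans ax xy; have az := connect_trans ay yz.
  have := multipartite h1 h4 aS bS cS ab ac bc ax ay az xz.
  by rewrite (negbTE nxy) h1 (negbTE nyz).
have inS v : v \in S :\: T -> v \in S by rewrite inE => /andP[].
(* Members of one part have the same neighbours in [H], and at untouched vertices [H] agrees with
   [E]. *)
have Rtwins u v : u \in S :\: T -> v \in S -> R u v -> v \notin T -> twins E S u v.
  move=> uU vS uv vT; have vU : v \in S :\: T by rewrite inE vT.
  have uS := inS u uU.
  apply/twinsP => w wS; rewrite -!HE //.
  have Hcuv : Hc u v by case/andP: uv.
  apply/idP/idP => hh; apply/negPn/negP => nh.
    have vw : R v w.
      rewrite /R nh andbT; apply: (@connect_trans _ _ u); first by rewrite csym.
      by apply: connect1; rewrite /induced uS wS.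
    by have /andP[_ /negP] := Rtrans _ _ _ uS uv vw; apply.
  have uw : R u w.
    rewrite /R nh andbT; apply: (@connect_trans _ _ v) => //.
    by apply: connect1; rewrite /induced vS wS.
  by move: uv; rewrite Rsym => vu; have /andP[_ /negP] := Rtrans _ _ _ vS vu uw; apply.
(* A set of untouched vertices inside one part consists of some [v] and twins of [v], of which
   [no_excess] allows at most [k.*2]. *)
have small (D : {set V}) : D \subset S :\: T -> {in D &, forall u v, R u v} -> #|D| <= k.*2.+1.
  move=> /subsetP DU DR; case: (set_0Vmem D) => [->|[v vD]]; first by rewrite cards0.
  have vU := DU v vD; have vS := inS v vU.
  rewrite (cardsD1 v) vD add1n ltnS.
  have := no_excess vS; rewrite /twin_excess -leqNgt; apply: leq_trans.
  apply: subset_leq_card; apply/subsetP => u; rewrite !inE => /andP[uv uD].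
  have uU := DU u uD; rewrite uv (inS _ uU) /=.
  apply: Rtwins => //; first exact: DR.
  by move: vU; rewrite inE => /andP[].
pose cls v := [set u in S :\: T | R v u].
have cls_small v : v \in S -> #|cls v| <= k.*2.+1.
  move=> vS; apply: small; first by apply/subsetP => u; rewrite inE => /andP[].
  move=> x y; rewrite !inE => /andP[/andP[_ xS] vx] /andP[_ vy].
  by apply: Rtrans vy => //; rewrite Rsym.
pose B t := [set v in S :\: T | Hc t v & [forall t' in T, ~~ R t' v]].
(* No touched vertex shares a part with [v]. A vertex at distance 2 that is not adjacent to [v] lies
   in the part of [v], so it is untouched and therefore a twin. *)
have Bdom t v : v \in B t -> dominant E S v.
  rewrite inE => /and3P[vU tv /forall_inP nT]; have vS := inS v vU.
  apply/dominantP => w u wS uS vw wu; case vu: (E v u) => //=.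
  have Rvu : R v u.
    rewrite /R HE // vu andbT.
    apply: connect_trans (connect1 (_ : induced H S v w)) (connect1 _).
      by rewrite /induced vS wS h3.
    by rewrite /induced wS uS h3.
  have uT : u \notin T by apply/negP => uT; have := nT u uT; rewrite Rsym Rvu.
  have : twins E S v u by apply: Rtwins.
  by move=> /twinsP tw; apply/twinsP => z zS; rewrite tw.
have B_adj t u v : u \in B t -> v \in B t -> v \notin cls u -> E u v.
  rewrite inE => /and3P[uU tu _]; rewrite inE => /and3P[vU tv _].
  rewrite inE vU /= /R negb_and negbK.
  have -> : Hc u v by apply: (@connect_trans _ _ t) => //; rewrite csym.
  by rewrite /= HE // inS.
have pick (D : {set V}) v n : v \in S -> n + k.*2.+1 < #|D| -> n < #|D :\: cls v|.
  move=> vS hn; have := cardsID (cls v) D.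
  have : #|D :&: cls v| <= k.*2.+1.
    by apply: leq_trans (cls_small v vS); apply: subset_leq_card; apply: subsetIr.
  by lia.
(* One part contributes at most [k.*2.+1] vertices, so a larger [B t] meets four parts. One vertex
   from each gives four pairwise adjacent dominant vertices, which [no_dominated] excludes. *)
have B_small t : #|B t| <= 3 * k.*2.+1.
  rewrite leqNgt; apply/negP => hB.
  have BS v : v \in B t -> v \in S by rewrite inE => /andP[/inS].
  have [v1 B1] : exists v, v \in B t by apply/card_gt0P; lia.
  have c1 : 2 * k.*2.+1 < #|B t :\: cls v1| by apply: pick; [apply: BS | lia].
  have [v2] : exists v, v \in B t :\: cls v1 by apply/card_gt0P; lia.
  rewrite in_setD => /andP[n12 B2].
  have c2 : k.*2.+1 < #|B t :\: cls v1 :\: cls v2| by apply: pick; [apply: BS | lia].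
  have [v3] : exists v, v \in B t :\: cls v1 :\: cls v2 by apply/card_gt0P; lia.
  rewrite !in_setD => /and3P[n23 n13 B3].
  have c3 : 0 < #|B t :\: cls v1 :\: cls v2 :\: cls v3| by apply: pick; [apply: BS | lia].
  have /card_gt0P[v4] := c3; rewrite !in_setD => /and4P[n34 n24 n14 B4].
  have := no_dominated (BS _ B1); rewrite /dominated_clique (Bdom _ _ B1) /= => /negP; apply.
  apply/existsP; exists v2; rewrite BS //=; apply/existsP; exists v3; rewrite BS //=.
  apply/existsP; exists v4; rewrite BS //=.
  by rewrite !(B_adj t) // (Bdom t).
have cover : S \subset T :|: \bigcup_(t in T) (cls t :|: B t).
  apply/subsetP => v vS; rewrite inE; case vT: (v \in T) => //=.
  have vU : v \in S :\: T by rewrite inE vT.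
  have [a [b [c [_ [_ _ _ _ [t tT vt]]]]]] := comp v vS.
  case: (boolP [forall t' in T, ~~ R t' v]) => hR.
    apply/bigcupP; exists t => //; rewrite inE; apply/orP; right.
    by rewrite inE vU hR andbT /= /Hc csym.
  move: hR; rewrite negb_forall => /existsP[t']; rewrite negb_imply negbK => /andP[tT' tv].
  by apply/bigcupP; exists t' => //; rewrite inE; apply/orP; left; rewrite inE vU.
have bnd : #|\bigcup_(t in T) (cls t :|: B t)| <= #|T| * (4 * k.*2.+1).
  apply: (@leq_trans (\sum_(t in T) #|cls t :|: B t|)).
    elim/big_rec2: _ => [|t n D _ IH]; first by rewrite cards0.
    by apply: leq_trans (leq_card_setU _ _) _; rewrite leq_add2l.
  rewrite -sum_nat_const; apply: leq_sum => t tT.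
  apply: leq_trans (leq_card_setU _ _) _.
  by have := cls_small t (TS t tT); have := B_small t; lia.
have := subset_leq_card cover; have := leq_card_setU T (\bigcup_(t in T) (cls t :|: B t)).
move=> c1 c2; have c3 := leq_trans c2 c1.
have c4 : #|T| * (4 * k.*2.+1) <= k.*2 * (4 * k.*2.+1) by rewrite leq_mul2r cT orbT.
by rewrite -mulnn; nia.
Qed.

End Bound.
End Kernel.
End Graphs.

(** * Derived commands and their evaluation *)

Definition And c1 c2 := Ite c1 c2 (Ret false).
Definition Neg c := Ite c (Ret false) (Ret true).
Definition Or c1 c2 := Ite c1 (Ret true) c2.
Definition When c d := Ite c d (Ret true).
(** A search that never succeeds visits every value. *)
Definition For x c := Ex x (Seq c (Ret false)).
Definition AddTo x z y := For x (When (Lt x y) (Inc z)).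

Lemma setregC x y v w s : x != y -> setreg x v (setreg y w s) = setreg y w (setreg x v s).
Proof.
move=> xy; rewrite /setreg /=; congr State; apply: functional_extensionality => i.
by rewrite /upd; case: (eqVneq i x) => // ->; rewrite (negbTE xy).
Qed.

Lemma reg_setreg x y v s : reg (setreg x v s) y = if y == x then v else reg s y.
Proof. by []. Qed.

Lemma setreg_same x v s : reg s x = v -> setreg x v s = s.
Proof. by move=> <-; apply: setreg_id. Qed.

Section Runs.
Variable N : nat.

Definition run c s := (sem N c s).2.
Definition test c s b := sem N c s = (b, s).

Lemma sem_Seq c1 c2 s : sem N (Seq c1 c2) s = sem N c2 (run c1 s).
Proof. by []. Qed.

Lemma run_Seq c1 c2 s : run (Seq c1 c2) s = run c2 (run c1 s).
Proof. by []. Qed.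

Lemma run_Ite c0 c1 c2 s b : test c0 s b -> run (Ite c0 c1 c2) s = if b then run c1 s else run c2 s.
Proof. by rewrite /run /test /= => ->; case: b. Qed.

Lemma run_When c d s b : test c s b -> run (When c d) s = if b then run d s else s.
Proof. by move/run_Ite=> ->. Qed.

(** The second test needs a known outcome only where the first succeeds, for instance where a
    register has just been found to hold a vertex. *)
Lemma test_And c1 c2 s b1 b2 : test c1 s b1 -> (b1 -> test c2 s b2) -> test (And c1 c2) s (b1 && b2).
Proof. by rewrite /test /= => ->; case: b1 => //= /(_ isT). Qed.

Lemma test_Or c1 c2 s b1 b2 : test c1 s b1 -> test c2 s b2 -> test (Or c1 c2) s (b1 || b2).
Proof. by rewrite /test /= => ->; case: b1. Qed.

Lemma test_Neg c s b : test c s b -> test (Neg c) s (~~ b).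
Proof. by rewrite /test /= => ->; case: b. Qed.

Lemma test_Ex x c s p : reg s x = 0 ->
  (forall v, v < N -> test c (setreg x v s) (p v)) -> test (Ex x c) s (has p (iota 0 N)).
Proof.
move=> hx H; rewrite /test /=.
have : forall v, v \in iota 0 N -> v < N by move=> v; rewrite mem_iota.
(* During the search the state differs from [s] at most in register [x], which the final reset
   restores. *)
suff G vs t : (forall v, v \in vs -> v < N) -> (forall w, setreg x w t = setreg x w s) ->
    (sem_ex (sem N c) x vs t).1 = has p vs /\
    setreg x 0 (sem_ex (sem N c) x vs t).2 = s.
  by move=> h; have [-> ->] := G _ s h (fun _ => erefl).
elim: vs t => [|v vs IH] t hv ht /=; first by rewrite ht setreg_same.
rewrite ht H ?hv ?mem_head //=; case: (p v) => /=.
  by rewrite setreg_setreg setreg_same.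
apply: IH => [w hw|w]; first by apply: hv; rewrite inE hw orbT.
by rewrite setreg_setreg.
Qed.

(** [st] turns abstract data into a machine state, so that a loop becomes a fold over the data that
    it changes; [inv] restricts these data, mostly to values below [N]. *)
Lemma run_For (A : Type) (st : A -> state) (g : A -> nat -> A) (inv : A -> Prop) x c a :
  (forall a, inv a -> reg (st a) x = 0) ->
  (forall v a, v < N -> inv a ->
     run c (setreg x v (st a)) = setreg x v (st (g a v)) /\ inv (g a v)) ->
  inv a -> run (For x c) (st a) = st (foldl g a (iota 0 N)).
Proof.
move=> hx H ha; rewrite /run /=.
have : forall v, v \in iota 0 N -> v < N by move=> v; rewrite mem_iota.
suff G vs t : (forall v, v \in vs -> v < N) -> (forall w, setreg x w t = setreg x w (st a)) ->
    setreg x 0 (sem_ex (sem N (Seq c (Ret false))) x vs t).2 = st (foldl g a vs).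
  by move=> h; rewrite (G _ (st a)).
elim: vs t a ha => [|v vs IH] t a' ha' hv ht /=; first by rewrite ht setreg_same // hx.
have [E i] := H v a' (hv v (mem_head _ _)) ha'.
apply: IH => // [w hw|w]; first by apply: hv; rewrite inE hw orbT.
by rewrite ht -/(run c _) E setreg_setreg.
Qed.

Lemma foldl_iotaS (A : Type) (g : A -> nat -> A) a v :
  foldl g a (iota 0 v.+1) = g (foldl g a (iota 0 v)) v.
Proof. by rewrite -addn1 iotaD /= foldl_cat. Qed.

Lemma count_iotaS (p : pred nat) v : count p (iota 0 v.+1) = count p (iota 0 v) + p v.
Proof. by rewrite -addn1 iotaD count_cat /= addn0. Qed.

Lemma run_Inc_count x z c s (p : pred nat) : x != z -> reg s x = 0 ->
  (forall v w, v < N -> test c (setreg x v (setreg z w s)) (p v)) -> reg s z < N ->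
  run (For x (When c (Inc z))) s = setreg z (minn (reg s z + count p (iota 0 N)) N.-1) s.
Proof.
move=> xz hx H hz.
pose g w v := if p v then minn w.+1 N.-1 else w.
have := @run_For nat (fun w => setreg z w s) g (fun w => w < N) x (When c (Inc z)) (reg s z).
rewrite setreg_id => -> //.
- congr setreg; suff G M : foldl g (reg s z) (iota 0 M) = minn (reg s z + count p (iota 0 M)) N.-1.
    exact: G.
  elim: M => [|v IH]; first by rewrite addn0 /=; lia.
  rewrite foldl_iotaS IH /g count_iotaS.
  by case: (p v) => /=; lia.
- by move=> w _; rewrite /= /upd (negbTE xz).
- move=> v w hv hw; split; last by rewrite /g; case: (p v); lia.
  rewrite (run_When _ (H v w hv)) /g; case: (p v) => //.
  rewrite /run /= [upd _ x v z]/upd eq_sym (negbTE xz) /upd eqxx.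
  by rewrite (setregC _ _ (setreg z w s)) 1?eq_sym // setreg_setreg.
Qed.

Lemma count_ltn v y : count (fun i => i < y) (iota 0 v) = minn v y.
Proof.
elim: v => [|v IH]; first by rewrite min0n.
by rewrite count_iotaS IH; case: (ltnP v y) => /=; lia.
Qed.

Lemma run_AddTo x z y s : x != z -> x != y -> y != z -> reg s x = 0 -> reg s z < N -> reg s y <= N ->
  run (AddTo x z y) s = setreg z (minn (reg s z + reg s y) N.-1) s.
Proof.
move=> xz xy yz hx hz hy; rewrite (@run_Inc_count _ _ _ _ (fun v => v < reg s y)) //.
  by rewrite count_ltn (minn_idPr hy).
move=> v w hv; rewrite /test /= /upd eqxx eq_sym (negbTE xy) (negbTE yz) //.
Qed.

End Runs.

(** * The kernelization as a register program *)

(* Registers: 0 holds [n], 1 holds [n + 1], 2-4 are scratch for [Edge], 5 and 6 hold [k] and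
   [2k] (saturated), 7 counts twins, 8 is the position of the first bit of [k], 9 and 10 serve
   to decode [k], 11 holds the size of the kernel, 12 the bound on it; registers from 20 on are
   loop variables.  Arrays: 0 is the input, 1 the set of surviving vertices, 2 the marks. *)
Definition ExS x c := Ex x (And (Bit 1 x) c).
Definition Xor c1 c2 := Ite c1 (Neg c2) c2.
Definition Neq x y := Or (Lt x y) (Lt y x).
(* The entry [(i, j)] of the adjacency matrix is the input bit number [n + 1 + i * n + j]. *)
Definition Edge i j := Seq (AddTo 3 2 1) (Seq (For 3 (When (Lt 3 i) (AddTo 4 2 0)))
  (Seq (AddTo 3 2 j) (Ite (Bit 0 2) (Seq (Zero 2) (Ret true)) (Seq (Zero 2) (Ret false))))).
Definition Twins u v := Neg (ExS 20 (Xor (Edge u 20) (Edge v 20))).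
Definition Dominant v := Neg (ExS 21 (ExS 22 (And (And (Edge v 21) (Edge 21 22))
  (Neg (Or (Edge v 22) (Twins 22 v)))))).
(** Register 7 is cleared in both branches, which keeps this a test without side effect. *)
Definition Excess v := Seq (For 23 (When (And (Bit 1 23) (And (Neq 23 v) (Twins 23 v))) (Inc 7)))
  (Ite (Lt 6 7) (Seq (Zero 7) (Ret true)) (Seq (Zero 7) (Ret false))).
Definition Clique v := And (Dominant v) (ExS 24 (ExS 25 (ExS 26
  (And (Edge v 24) (And (Edge v 25) (And (Edge v 26) (And (Edge 24 25) (And (Edge 24 26)
  (And (Edge 25 26) (Dominant 24)))))))))).
Definition PawAt x := And (Bit 1 x) (ExS 27 (ExS 28 (ExS 29
  (And (Edge x 27) (And (Edge 27 28) (And (Edge x 28) (And (Edge 28 29)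
  (And (Neg (Edge x 29)) (Neg (Edge 27 29)))))))))).

Definition Mark := Seq (For 30 (Put 2 30 false)) (Seq (For 30 (When (PawAt 30) (Put 2 30 true)))
  (Seq (For 31 (For 32 (For 33 (When (And (Bit 2 32) (And (Bit 1 33) (Edge 32 33))) (Put 2 33 true)))))
  (For 30 (When (Neg (Bit 2 30)) (Put 1 30 false))))).
Definition Prune := For 30 (When (And (Bit 1 30) (Or (Excess 30) (Clique 30))) (Put 1 30 false)).
Definition Reduce := For 34 (Seq Mark Prune).

(** * Vertex sets as arrays, and the encoded instance *)

Definition setarray A P s := State (reg s) (fun A' => if A' == A then P else arr s A') (out s).

Lemma setarrayK A P Q s : setarray A P (setarray A Q s) = setarray A P s.
Proof. by rewrite /setarray /=; congr State; apply: functional_extensionality => a; case: eqP. Qed.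

Lemma setarray_id A s : setarray A (arr s A) s = s.
Proof.
case: s => r a o; rewrite /setarray /=; congr State.
by apply: functional_extensionality => b; case: eqP => [->|].
Qed.

Lemma setarr_setarray A p b P s :
  setarr A p b (setarray A P s) = setarray A (fun p' => if p' == p then b else P p') s.
Proof.
rewrite /setarr /setarray /=; congr State; apply: functional_extensionality => a.
apply: functional_extensionality => q; rewrite /setbit; case: eqP => //= _.
Qed.

Lemma setreg_setarray x v A P s : setreg x v (setarray A P s) = setarray A P (setreg x v s).
Proof. by []. Qed.

Lemma nth_flatten_uniform (I A : Type) (i0 : I) (x0 : A) (r : I -> seq A) m s a j :
  (forall i, size (r i) = m) -> a < size s -> j < m ->
  nth x0 (flatten [seq r i | i <- s]) (a * m + j) = nth x0 (r (nth i0 s a)) j.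
Proof.
move=> hr; elim: s a => //= i s IH [|a] ha hj; rewrite nth_cat hr.
  by rewrite mul0n hj.
by rewrite ifF ?mulSn; [rewrite -addnA addKn IH | lia].
Qed.

Section Enc.
Variables (n : nat) (E : rel 'I_n) (k : nat).
Let inp := enc E k.

Lemma size_bin_gt0 : 0 < size (bin k).
Proof. by rewrite size_map size_iota. Qed.

Lemma size_matrix : size [seq E i j | i <- enum 'I_n, j <- enum 'I_n] = n * n.
Proof. by rewrite size_allpairs size_enum_ord. Qed.

Lemma size_enc : size inp = n.+1 + n * n + size (bin k).
Proof. by rewrite /inp /enc size_cat size_nseq [size (_ :: _)]/= size_cat size_matrix; lia. Qed.

Lemma enc_edge (i j : 'I_n) : nth false inp (n.+1 + i * n + j) = E i j.
Proof.
rewrite /inp /enc nth_cat size_nseq ifF; last by lia.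
rewrite (_ : _ - n = (i * n + j).+1) /=; last by lia.
rewrite nth_cat size_matrix.
have -> : i * n + j < n * n by apply: cell_lt.
rewrite /allpairs_dep (nth_flatten_uniform i _ (m := n)) ?size_enum_ord //.
  by rewrite (nth_map j) ?size_enum_ord // !nth_ord_enum.
by move=> i'; rewrite size_map size_enum_ord.
Qed.

(** The code begins with [n] ones and a zero, so a position is below [n] exactly when no zero occurs
    up to it. This is how [Init] decodes [n]. *)
Lemma enc_prefix a : a < size inp ->
  ~~ has (fun b => ~~ (a < b) && ~~ nth false inp b) (iota 0 (size inp)) = (a < n).
Proof.
move=> ha; apply/hasPn/idP => [h|an b].
  rewrite ltnNge; apply/negP => na.
  have hn : n \in iota 0 (size inp) by rewrite mem_iota; apply: leq_ltn_trans ha.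
  by have := h n hn; rewrite -leqNgt na /inp /enc nth_cat size_nseq ltnn subnn.
rewrite -leqNgt => _; apply/negP => /andP[ba].
by rewrite /inp /enc nth_cat size_nseq nth_nseq (leq_ltn_trans ba an).
Qed.

Lemma enc_bits : drop (n.+1 + n * n) inp = bin k.
Proof.
rewrite /inp /enc drop_cat size_nseq ifF; last by lia.
rewrite (_ : _ - n = (n * n).+1) /=; last by lia.
by rewrite drop_cat size_matrix ltnn subnn drop0.
Qed.

End Enc.

(** Loop variables run through all values below the input length, far beyond [n]. The value [false]
    there makes [Bit 1 x] also check that [x] holds a vertex. *)
Definition inset n (S : {set 'I_n}) (p : nat) : bool := if insub p is Some i then i \in S else false.

Lemma inset_ord n (S : {set 'I_n}) (i : 'I_n) : inset S i = (i \in S).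
Proof. by rewrite /inset valK. Qed.

Lemma inset_ge n (S : {set 'I_n}) p : n <= p -> inset S p = false.
Proof. by move=> h; rewrite /inset insubF // ltnNge h. Qed.

Definition zero (l : seq nat) s := {in l, forall x, reg s x = 0}.

Lemma zero_sub l l' s : all (mem l) l' -> zero l s -> zero l' s.
Proof. by move=> /allP h z x /h; apply: z. Qed.

Lemma notin_sub (l l' : seq nat) x : all (mem l) l' -> x \notin l -> x \notin l'.
Proof. by move=> /allP h; apply: contra => /h. Qed.

Lemma notin_neq (l : seq nat) x y : y \in l -> x \notin l -> x != y.
Proof. by move=> yl; apply: contraNneq => ->. Qed.

Lemma zero_setreg l x v s : x \notin l -> zero l s -> zero l (setreg x v s).
Proof. by move=> h z y hy; rewrite reg_setreg; case: eqP => [E|_]; [move: h; rewrite -E hy | apply: z]. Qed.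

(** * Correctness of the graph tests *)

Section Tests.
Variables (n : nat) (E : rel 'I_n) (k : nat).
Let inp := enc E k.
Let N := size inp.

Let N_ge : n.+1 + n * n < N.
Proof. by rewrite /N size_enc; have := size_bin_gt0 k; lia. Qed.
Let N_gt : n.+1 < N. Proof. by apply: leq_ltn_trans N_ge; rewrite leq_addr. Qed.

(* Saturation of [k] and [2k] at [N.-1] is harmless: they are only compared with
   cardinals, which are at most [n < N.-1]. *)
Record base (S : {set 'I_n}) s : Prop := Base {
  base_inp : arr s 0 = nth false inp;
  base_S : arr s 1 = inset S;
  base_n : reg s 0 = n;
  base_n1 : reg s 1 = n.+1;
  base_k : reg s 5 = minn k N.-1;
  base_2k : reg s 6 = minn k.*2 N.-1;
  base_q : reg s 8 = n.+1 + n * n }.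

Lemma base_setreg S x v s : x \notin [:: 0; 1; 5; 6; 8] -> base S s -> base S (setreg x v s).
Proof.
rewrite !inE !negb_or => /and5P[h0 h1 h5 h6 h8] [*].
by split; rewrite // reg_setreg eq_sym ?(negbTE h0, negbTE h1, negbTE h5, negbTE h6, negbTE h8).
Qed.

Lemma base_setarray S S' s : base S s -> base S' (setarray 1 (inset S') s).
Proof. by case=> *; split. Qed.

Lemma base_setarray2 S P s : base S s -> base S (setarray 2 P s).
Proof. by case=> *; split. Qed.

Lemma base_out S o s : base S s -> base S (State (reg s) (arr s) o).
Proof. by case=> *; split. Qed.

Lemma test_Bit1 S s x (u : 'I_n) : base S s -> reg s x = u -> test N (Bit 1 x) s (u \in S).
Proof. by move=> bs ux; rewrite /test /= ux (base_S bs) inset_ord. Qed.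

Lemma test_ExS S x c s (q : pred 'I_n) : base S s -> reg s x = 0 ->
  (forall u : 'I_n, u \in S -> test N c (setreg x u s) (q u)) ->
  test N (ExS x c) s [exists u in S, q u].
Proof.
move=> bs hx H.
pose p v := if insub v is Some u then (u \in S) && q u else false.
have -> : [exists u in S, q u] = has p (iota 0 N).
  apply/exists_inP/hasP => [[u uS qu]|[v _]].
    exists (val u); first by rewrite mem_iota /= add0n (ltn_trans (ltn_ord u)) // ltnW.
    by rewrite /p valK uS.
  by rewrite /p; case: insubP => // u _ _ /andP[]; exists u.
apply: test_Ex => // v hv; rewrite /p; case: insubP => [u _ <-|nv].
  apply: test_And; last exact: H.
  by rewrite /test /= (base_S bs) /upd eqxx inset_ord.
by rewrite /test /= (base_S bs) /upd eqxx inset_ge // leqNgt.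
Qed.

(** Working registers: a test finds them 0, leaves them 0, and must not receive its arguments in
    them. *)
Definition scratch := [:: 2; 3; 4].

Lemma test_Edge S s x y (u v : 'I_n) : base S s -> zero scratch s ->
  x \notin scratch -> y \notin scratch -> reg s x = u -> reg s y = v ->
  test N (Edge x y) s (E u v).
Proof.
move=> bs z; rewrite !inE !negb_or => /and3P[x2 x3 x4] /and3P[y2 y3 y4] xu yv.
have z2 : reg s 2 = 0 by apply: z. have z3 : reg s 3 = 0 by apply: z.
have z4 : reg s 4 = 0 by apply: z.
(* Addresses of matrix entries stay below [n.+1 + n * n], which is less than [N], so none of the
   additions saturates. *)
have un : u * n + v < n * n by apply: cell_lt.
have e1 : run N (AddTo 3 2 1) s = setreg 2 n.+1 s.
  rewrite run_AddTo // ?z2 ?(base_n1 bs) //; try by lia.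
  by congr setreg; lia.
have e2 : run N (For 3 (When (Lt 3 x) (AddTo 4 2 0))) (setreg 2 n.+1 s) = setreg 2 (n.+1 + u * n) s.
  pose g w a := if a < u then minn (w + n) N.-1 else w.
  rewrite (@run_For N nat (fun w => setreg 2 w s) g (fun w => w < N)) //; first last.
  - move=> a w ha hw; rewrite (@run_When _ _ _ _ (a < u)); last first.
      by rewrite /test /= /upd eqxx (negbTE x2) (negbTE x3) xu.
    split; last by rewrite /g; case: ifP; lia.
    rewrite /g; case: ifP => // au; rewrite run_AddTo // !reg_setreg /= ?(base_n bs) //; last by lia.
    by rewrite (setregC _ _ (setreg 2 w s)) // setreg_setreg.
  congr setreg; suff G m : foldl g n.+1 (iota 0 m) = n.+1 + minn m u * n.
    by rewrite G (minn_idPr _) // ltnW // (ltn_trans (ltn_ord u)) // ltnW.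
  elim: m => [|m IH]; first by rewrite min0n mul0n addn0.
  rewrite foldl_iotaS IH /g; case: (ltnP m u) => mu.
    have -> : minn m.+1 u = m.+1 by lia.
    have : m.+1 * n <= n * n by rewrite leq_mul2r (leq_trans mu) ?orbT // ltnW.
    by rewrite mulSn; lia.
  by have -> : minn m.+1 u = u by lia.
have e3 : run N (AddTo 3 2 y) (setreg 2 (n.+1 + u * n) s) = setreg 2 (n.+1 + u * n + v) s.
  rewrite run_AddTo // ?reg_setreg ?eqxx //= ?(negbTE y2) ?yv; try lia.
    by rewrite setreg_setreg; congr setreg; lia.
rewrite /test /Edge !sem_Seq e1 e2 e3 /= (base_inp bs) /upd eqxx enc_edge.
by case: (E u v); rewrite /= setreg_setreg setreg_same.
Qed.

Lemma test_Xor c1 c2 s b1 b2 : test N c1 s b1 -> test N c2 s b2 -> test N (Xor c1 c2) s (b1 (+) b2).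
Proof. by rewrite /test /= => ->; case: b1 => /= ->; case: b2. Qed.

Lemma test_Neq x y s : test N (Neq x y) s (reg s x != reg s y).
Proof. by rewrite neq_ltn; apply: test_Or. Qed.

Lemma reg_other x y (l : seq nat) v s : y \in l -> x \notin l -> reg (setreg y v s) x = reg s x.
Proof. by move=> yl xl; rewrite reg_setreg (negbTE (notin_neq yl xl)). Qed.

Definition scr_twins := 20 :: scratch.

Lemma test_Twins S s x y (u v : 'I_n) : base S s -> zero scr_twins s ->
  x \notin scr_twins -> y \notin scr_twins -> reg s x = u -> reg s y = v ->
  test N (Twins x y) s (twins E S u v).
Proof.
move=> bs z hx hy xu yv.
have -> : twins E S u v = ~~ [exists w in S, E u w (+) E v w].
  rewrite negb_exists_in; apply: eq_forallb_in => w _.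
  by case: (E u w); case: (E v w).
apply/test_Neg/(test_ExS bs); first by apply: z.
move=> w wS; apply: test_Xor; apply: (@test_Edge S); rewrite ?(reg_other _ _ _ hx) ?(reg_other _ _ _ hy) //;
  try (by apply: base_setreg); try (by apply: zero_setreg => //; apply: zero_sub z);
  by apply: (@notin_sub scr_twins).
Qed.

Definition scr_dom := 21 :: 22 :: scr_twins.

Lemma test_Dominant S s x (v : 'I_n) : base S s -> zero scr_dom s -> x \notin scr_dom ->
  reg s x = v -> test N (Dominant x) s (dominant E S v).
Proof.
move=> bs z hx xv.
have -> : dominant E S v = ~~ [exists w in S, [exists u in S,
    (E v w && E w u) && ~~ (E v u || twins E S u v)]].
  rewrite negb_exists_in; apply: eq_forallb_in => w _.
  rewrite negb_exists_in; apply: eq_forallb_in => u _.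
  by rewrite negb_and negbK implybE.
apply/test_Neg/(test_ExS bs); first by apply: z.
move=> w wS; apply: (@test_ExS S); first exact: base_setreg.
  by rewrite reg_setreg; apply: z.
move=> u uS; set t := setreg 22 u _.
have bt : base S t by do 2 apply: base_setreg => //.
have zt : zero scr_twins t by do 2 apply: zero_setreg => //; apply: zero_sub z.
have zt' : zero scratch t by apply: zero_sub zt.
have hx1 : x \notin scr_twins by apply: notin_sub hx.
have hx2 : x \notin scratch by apply: notin_sub hx.
have tx : reg t x = v by rewrite !(reg_other _ _ _ hx).
apply: test_And => [|_]; first by apply: test_And => [|_]; apply: (@test_Edge S).
by apply/test_Neg/test_Or; [apply: (@test_Edge S)|apply: (@test_Twins S)].
Qed.

Definition scr_clique := 24 :: 25 :: 26 :: scr_dom.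

Lemma test_Clique S s x (v : 'I_n) : base S s -> zero scr_clique s -> x \notin scr_clique ->
  reg s x = v -> test N (Clique x) s (dominated_clique E S v).
Proof.
move=> bs z hx xv; apply: test_And => [|_].
  by apply: (@test_Dominant S) => //; [apply: zero_sub z | apply: notin_sub hx].
apply: (test_ExS bs); first by apply: z.
move=> a aS; apply: (@test_ExS S); [exact: base_setreg|by rewrite reg_setreg; apply: z|].
move=> b bS; apply: (@test_ExS S); [by do 2 apply: base_setreg => //|by rewrite !reg_setreg; apply: z|].
move=> c cS; set t := setreg 26 c _.
have bt : base S t by do 3 apply: base_setreg => //.
have zt : zero scr_dom t by do 3 apply: zero_setreg => //; apply: zero_sub z.
have zt' : zero scratch t by apply: zero_sub zt.
have hx2 : x \notin scratch by apply: notin_sub hx.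
have tx : reg t x = v by rewrite !(reg_other _ _ _ hx).
do 6! (apply: test_And => [|_]; first by apply: (@test_Edge S)).
exact: (@test_Dominant S).
Qed.

Definition scr_paw := 27 :: 28 :: 29 :: scratch.

Lemma test_PawAt S s x (v : 'I_n) : base S s -> zero scr_paw s -> x \notin scr_paw ->
  reg s x = v -> test N (PawAt x) s ((v \in S) &&
    [exists x2 in S, [exists x3 in S, [exists x4 in S, paw E v x2 x3 x4]]]).
Proof.
move=> bs z hx xv; apply: test_And => [|_]; first exact: test_Bit1.
apply: (test_ExS bs); first by apply: z.
move=> a aS; apply: (@test_ExS S); [exact: base_setreg|by rewrite reg_setreg; apply: z|].
move=> b bS; apply: (@test_ExS S); [by do 2 apply: base_setreg => //|by rewrite !reg_setreg; apply: z|].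
move=> c cS; set t := setreg 29 c _.
have bt : base S t by do 3 apply: base_setreg => //.
have zt : zero scratch t by do 3 apply: zero_setreg => //; apply: zero_sub z.
have hx2 : x \notin scratch by apply: notin_sub hx.
have tx : reg t x = v by rewrite !(reg_other _ _ _ hx).
do 4! (apply: test_And => [|_]; first by apply: (@test_Edge S)).
by apply: test_And => [|_]; apply: test_Neg; apply: (@test_Edge S).
Qed.

Lemma count_inset (S : {set 'I_n}) (q : pred 'I_n) :
  count (fun p => if insub p is Some u then (u \in S) && q u else false) (iota 0 N) =
  #|[set u in S | q u]|.
Proof.
have -> : iota 0 N = [seq val i | i <- enum 'I_n] ++ iota n (N - n).
  by rewrite val_enum_ord -{2}(add0n n) -iotaD subnKC // ltnW // (leq_ltn_trans _ N_gt).
rewrite count_cat count_map [X in _ + X](_ : _ = 0) ?addn0; last first.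
  apply/eqP; rewrite -leqn0 leqNgt -has_count; apply/hasPn => p; rewrite mem_iota => /andP[h _].
  by case: insubP => // u _ E1; move: h; rewrite -E1 leqNgt ltn_ord.
rewrite cardE {2}/enum_mem size_filter -enumT.
by apply: eq_count => u; rewrite /= valK inE.
Qed.

Lemma run_CountS S s x z c (q : pred 'I_n) : base S s -> x != z -> x \notin [:: 0; 1; 5; 6; 8] ->
  z \notin [:: 0; 1; 5; 6; 8] -> reg s x = 0 -> reg s z = 0 ->
  (forall w (u : 'I_n), u \in S -> test N c (setreg x u (setreg z w s)) (q u)) ->
  run N (For x (When (And (Bit 1 x) c) (Inc z))) s = setreg z #|[set u in S | q u]| s.
Proof.
move=> bs xz xb zb hx hz H.
rewrite (@run_Inc_count N x z _ s (fun p => if insub p is Some u then (u \in S) && q u else false)) //.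
- rewrite hz count_inset add0n; congr setreg; apply/minn_idPl.
  apply: leq_trans (max_card _) _; rewrite card_ord; have := N_gt; lia.
- move=> v w hv; have bt : base S (setreg x v (setreg z w s)) by do 2 apply: base_setreg => //.
  case: insubP => [u _ uv|nv].
    apply: test_And; last by rewrite -uv; apply: H.
    by apply: (test_Bit1 bt); rewrite reg_setreg eqxx.
  apply: (@test_And N (Bit 1 x) c _ false false) => //.
    by rewrite /test /= (base_S bs) /upd eqxx inset_ge // leqNgt.
- by rewrite hz; apply: leq_ltn_trans N_gt.
Qed.

Definition scr_excess := 23 :: 7 :: scr_twins.

Lemma test_Excess S s x (v : 'I_n) : base S s -> zero scr_excess s -> x \notin scr_excess ->
  reg s x = v -> test N (Excess x) s (twin_excess E S k v).
Proof.
move=> bs z hx xv.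
have e : run N (For 23 (When (And (Bit 1 23) (And (Neq 23 x) (Twins 23 x))) (Inc 7))) s =
    setreg 7 #|[set u in S | (u != v) && twins E S u v]| s.
  apply: run_CountS; rewrite //; try by apply: z.
  move=> w u uS; set t := setreg 23 u _.
  have tx : reg t x = v by rewrite !(reg_other _ _ _ hx).
  apply: test_And => [|_].
    by have := test_Neq 23 x t; rewrite tx reg_setreg eqxx.
  apply: (@test_Twins S) => //; last by apply: notin_sub hx.
    by do 2 apply: base_setreg => //.
  by do 2 apply: zero_setreg => //; apply: zero_sub z.
rewrite /test /Excess sem_Seq e /= /upd /= (base_2k bs).
have z7 : reg s 7 = 0 by apply: z.
set m := #|_|; have hm : m <= n by apply: leq_trans (max_card _) _; rewrite card_ord.
have -> : (minn k.*2 N.-1 < m) = twin_excess E S k v.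
  by rewrite /twin_excess -/m; have := N_gt; lia.
by case: twin_excess; rewrite /= setreg_setreg setreg_same.
Qed.

Definition deletable S v := twin_excess E S k v || dominated_clique E S v.

Lemma run_For_ord (A : Type) (st : A -> state) (g : A -> 'I_n -> A) x c a :
  (forall a, reg (st a) x = 0) ->
  (forall (v : 'I_n) a, run N c (setreg x v (st a)) = setreg x v (st (g a v))) ->
  (forall v a, n <= v -> run N c (setreg x v (st a)) = setreg x v (st a)) ->
  run N (For x c) (st a) = st (foldl g a (enum 'I_n)).
Proof.
move=> hx h1 h2; pose g' a v := if insub v is Some u then g a u else a.
rewrite (@run_For N A st g' (fun _ => True)) //; last first.
  move=> v b _ _; split=> //; rewrite /g'; case: insubP => [u _ <-|nv]; first exact: h1.
  by apply: h2; rewrite leqNgt.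
have -> : iota 0 N = [seq val i | i <- enum 'I_n] ++ iota n (N - n).
  by rewrite val_enum_ord -{2}(add0n n) -iotaD subnKC // ltnW // (leq_ltn_trans _ N_gt).
rewrite foldl_cat; set b := foldl g' a _.
have -> : b = foldl g a (enum 'I_n).
  rewrite /b; elim: (enum 'I_n) (a) => //= i s IH a'.
  by rewrite {2}/g' valK IH.
congr st; have : forall p, p \in iota n (N - n) -> n <= p by move=> p; rewrite mem_iota => /andP[].
elim: (iota n _) (foldl g a _) => //= p s IH b' hp.
rewrite {2}/g' insubF ?IH // => [q hq|]; first by apply: hp; rewrite inE hq orbT.
by apply/negbTE; rewrite -leqNgt hp ?mem_head.
Qed.

End Tests.

Lemma zero_setarray l A P s : zero l s -> zero l (setarray A P s).
Proof. by []. Qed.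

Lemma inset_add n (S : {set 'I_n}) (v : 'I_n) :
  (fun p : nat => if p == v then true else inset S p) = inset (v |: S).
Proof.
apply: functional_extensionality => p; rewrite /inset; case: insubP => [u _ <-|h].
  by rewrite in_setU1 -val_eqE; case: eqP.
by case: eqP h => // ->; rewrite ltn_ord.
Qed.

Lemma inset_del n (S : {set 'I_n}) (v : 'I_n) :
  (fun p : nat => if p == v then false else inset S p) = inset (S :\ v).
Proof.
apply: functional_extensionality => p; rewrite /inset; case: insubP => [u _ <-|_].
  by rewrite in_setD1 -val_eqE; case: eqP.
by case: eqP.
Qed.

Lemma inset_del_ge n (S : {set 'I_n}) v : n <= v ->
  (fun p : nat => if p == v then false else inset S p) = inset S.
Proof. by move=> h; apply: functional_extensionality => p; case: eqP => // ->; rewrite inset_ge. Qed.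

Lemma foldl_add (T : finType) (p : pred T) (M : {set T}) s :
  foldl (fun M v => if p v then v |: M else M) M s = M :|: [set v in s | p v].
Proof.
elim: s M => [|v s IH] M /=; first by apply/setP => u; rewrite !inE ?orbF.
rewrite IH; apply/setP => u; case: ifP => pv; rewrite !inE; case: eqP => [->|] //=; rewrite ?pv ?andbF ?orbT //.
Qed.

Lemma foldl_del (T : finType) (p : pred T) (M : {set T}) s :
  foldl (fun M v => if p v then M :\ v else M) M s = M :\: [set v in s | p v].
Proof.
elim: s M => [|v s IH] M /=; first by apply/setP => u; rewrite !inE.
rewrite IH; apply/setP => u; case: ifP => pv; rewrite !inE; case: eqP => [->|] //=; rewrite ?pv ?andbF //.
Qed.

(** * Correctness of the reduction loop *)

Section Reduction.
Variables (n : nat) (E : rel 'I_n) (k : nat).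
Let inp := enc E k.
Let N := size inp.

(** Each test refers to the set left by the earlier deletions: twins can justify the removal of one
    another, so deleting all deletable vertices at once would not be justified. *)
Definition prune1 (S : {set 'I_n}) v := if (v \in S) && deletable E k S v then S :\ v else S.
Definition prune S := foldl prune1 S (enum 'I_n).
(** Only the vertex [x1] of each paw is recorded; spreading along edges reaches the rest of its
    component. *)
Definition paws (S : {set 'I_n}) := [set v in S |
  [exists x2 in S, [exists x3 in S, [exists x4 in S, paw E v x2 x3 x4]]]].
Definition spread1 (S : {set 'I_n}) i M :=
  foldl (fun (M : {set 'I_n}) j => if [&& i \in M, j \in S & E i j] then j |: M else M) M (enum 'I_n).
Definition spread S M := foldl (fun M i => spread1 S i M) M (enum 'I_n).
(* The vertices connected to a paw; any number of rounds that is at least [n] would do. *)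
Definition mark S := iter N (spread S) (paws S).

Definition scr_prune := 30 :: (scr_excess ++ scr_clique).

Lemma run_Prune S s : base E k S s -> zero scr_prune s ->
  run N Prune s = setarray 1 (inset (prune S)) s.
Proof.
move=> bs z; rewrite -{1}(setarray_id 1 s) (base_S bs).
apply: (@run_For_ord n E k _ (fun S => setarray 1 (inset S) s) prune1).
- by move=> S'; apply: z.
- move=> v S'; set t := setreg 30 v _.
  have bt : base E k S' t by apply: base_setreg => //; apply: base_setarray bs.
  have zt l : all (mem scr_prune) l -> 30 \notin l -> zero l t.
    by move=> h1 h2; apply: zero_setreg => //; apply/zero_setarray/zero_sub/z.
  rewrite (@run_When _ _ _ _ ((v \in S') && deletable E k S' v)); last first.
    apply: test_And => [|_]; first exact: (test_Bit1 bt).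
    apply: test_Or; first by apply: (@test_Excess _ _ _ S') => //; apply: zt.
    by apply: (@test_Clique _ _ _ S') => //; apply: zt.
  rewrite /prune1; case: ifP => // _.
  by rewrite /run /= /upd eqxx /t setreg_setarray setarr_setarray inset_del -setreg_setarray.
- move=> v S' hv; rewrite (@run_When _ _ _ _ false) //.
  apply: (@test_And _ _ _ _ false false) => //.
  by rewrite /test /= /upd eqxx inset_ge.
Qed.

Definition scr_mark := 30 :: 31 :: 32 :: 33 :: scr_paw.

Let mark_clear (M : {set 'I_n}) s : zero scr_mark s ->
  run N (For 30 (Put 2 30 false)) (setarray 2 (inset M) s) = setarray 2 (inset (set0 : {set 'I_n})) s.
Proof.
move=> z; rewrite (@run_For_ord n E k _ (fun M => setarray 2 (inset M) s)
  (fun M v => if predT v then M :\ v else M)); first last.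
- by move=> v S' hv; rewrite /run /= /upd eqxx setreg_setarray setarr_setarray inset_del_ge.
- by move=> v S'; rewrite /run /= /upd eqxx setreg_setarray setarr_setarray inset_del.
- by move=> ?; apply: z.
by rewrite (foldl_del predT); congr (setarray 2 (inset _) _); apply/setP => u; rewrite !inE mem_enum.
Qed.

Let mark_paws S s : base E k S s -> zero scr_mark s ->
  run N (For 30 (When (PawAt 30) (Put 2 30 true))) (setarray 2 (inset (set0 : {set 'I_n})) s) =
  setarray 2 (inset (paws S)) s.
Proof.
move=> bs z; rewrite (@run_For_ord n E k _ (fun M => setarray 2 (inset M) s)
  (fun M v => if v \in paws S then v |: M else M)); first last.
- move=> v M hv; rewrite (@run_When _ _ _ _ false) //.
  apply: (@test_And _ _ _ _ false false) => //.
  by rewrite /test /= (base_S bs) /upd eqxx inset_ge.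
- move=> v M; set t := setreg 30 v _.
  have bt : base E k S t by apply: base_setreg => //; apply: base_setarray2.
  rewrite (@run_When _ _ _ _ (v \in paws S)); last first.
    rewrite inE; apply: (@test_PawAt _ _ _ S) => //.
    by apply: zero_setreg => //; apply/zero_setarray/zero_sub/z.
  case: ifP => // _.
  by rewrite /run /= /upd eqxx /t setreg_setarray setarr_setarray inset_add -setreg_setarray.
- by move=> ?; apply: z.
by rewrite foldl_add; congr (setarray 2 (inset _) _); apply/setP => u; rewrite !inE mem_enum.
Qed.

Let mark_spread S (M : {set 'I_n}) s : base E k S s -> zero (behead (behead scr_mark)) s ->
  run N (For 32 (For 33 (When (And (Bit 2 32) (And (Bit 1 33) (Edge 32 33))) (Put 2 33 true))))
    (setarray 2 (inset M) s) = setarray 2 (inset (spread S M)) s.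
Proof.
move=> bs z; apply: (@run_For_ord n E k _ (fun M => setarray 2 (inset M) s) (fun M i => spread1 S i M)).
- by move=> ?; apply: z.
- move=> i {}M; rewrite setreg_setarray.
  apply: (@run_For_ord n E k _ (fun M => setarray 2 (inset M) (setreg 32 i s))).
  + by move=> ?; rewrite reg_setreg; apply: z.
  + move=> j {}M; set t := setreg 33 j _.
    have bt : base E k S t by apply: base_setreg => //; apply: base_setarray2; apply: base_setreg.
    rewrite (@run_When _ _ _ _ [&& i \in M, j \in S & E i j]); last first.
      apply: test_And => [|_]; first by rewrite /test /= /upd /= inset_ord.
      apply: test_And => [|_]; first exact: (test_Bit1 bt).
      apply: (@test_Edge _ _ _ S) => //.
      by apply: zero_setreg => //; apply/zero_setarray/zero_setreg => //; apply: zero_sub z.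
    case: ifP => // _.
    by rewrite /run /= /upd eqxx /t setreg_setarray setarr_setarray inset_add -setreg_setarray.
  + move=> j {}M hj; rewrite (@run_When _ _ _ _ false) //.
    rewrite -[false](andbF (i \in M)); apply: test_And => [|_]; last first.
      apply: (@test_And _ _ _ _ false false) => //.
      by rewrite /test /= (base_S bs) /upd eqxx inset_ge.
    by rewrite /test /= /upd /= inset_ord.
- move=> i {}M hi; rewrite setreg_setarray.
  rewrite (@run_For_ord n E k _ (fun M => setarray 2 (inset M) (setreg 32 i s)) (fun M _ => M)).
  + by congr (setarray 2 (inset _) _); elim: (enum _).
  + by move=> ?; rewrite reg_setreg; apply: z.
  + move=> j {}M; rewrite (@run_When _ _ _ _ false) //.
    apply: (@test_And _ _ _ _ false false) => //.
    by rewrite /test /= /upd /= inset_ge.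
  + move=> j {}M hj; rewrite (@run_When _ _ _ _ false) //.
    apply: (@test_And _ _ _ _ false false) => //.
    by rewrite /test /= /upd /= inset_ge.
Qed.

Lemma foldl_const (A B : Type) (f : A -> A) a (l : seq B) : foldl (fun x _ => f x) a l = iter (size l) f a.
Proof. by elim: l a => //= b l IH a; rewrite IH -iterSr. Qed.

Lemma run_Mark S M s : base E k S s -> arr s 2 = inset (M : {set 'I_n}) -> zero scr_mark s ->
  run N Mark s = setarray 1 (inset (S :&: mark S)) (setarray 2 (inset (mark S)) s).
Proof.
move=> bs a2 z; rewrite /Mark !run_Seq -{1}(setarray_id 2 s) a2 mark_clear // (mark_paws bs) //.
rewrite (@run_For N _ (fun M => setarray 2 (inset M) s) (fun M _ => spread S M) (fun _ => True)) //; first last.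
- move=> v M' _ _; split=> //; rewrite setreg_setarray (@mark_spread S) //; first exact: base_setreg.
  by apply: zero_setreg => //; apply: zero_sub z.
- by move=> ? _; apply: z.
rewrite foldl_const size_iota -/(mark S); set t := setarray 2 _ s.
have bt : base E k S t by apply: base_setarray2.
rewrite -{1}(setarray_id 1 t) (base_S bt).
have bit (M' : {set 'I_n}) v : test N (Bit 2 30) (setreg 30 v (setarray 1 (inset M') t)) (inset (mark S) v).
  by rewrite /test /= /upd.
rewrite (@run_For_ord n E k _ (fun M => setarray 1 (inset M) t)
  (fun S' v => if v \notin mark S then S' :\ v else S')); first last.
- move=> v M' hv; rewrite (run_When _ (test_Neg (bit _ _))) inset_ge //.
  by rewrite /run /= /upd eqxx setreg_setarray setarr_setarray inset_del_ge // -setreg_setarray.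
- move=> v M'; rewrite (run_When _ (test_Neg (bit _ _))) inset_ord; case: ifP => // _.
  by rewrite /run /= /upd eqxx setreg_setarray setarr_setarray inset_del -setreg_setarray.
- by move=> ?; apply: z.
rewrite foldl_del; congr (setarray 1 (inset _) _); apply/setP => u.
by rewrite !inE mem_enum negbK andbC.
Qed.

Definition reduce1 S := prune (S :&: mark S).
Definition reduced := iter N reduce1 [set: 'I_n].
Definition scr_reduce := 34 :: (scr_prune ++ scr_mark).

Lemma run_Reduce s : base E k [set: 'I_n] s -> arr s 2 = inset (set0 : {set 'I_n}) ->
  zero scr_reduce s -> exists M : {set 'I_n},
  run N Reduce s = setarray 1 (inset reduced) (setarray 2 (inset M) s).
Proof.
move=> bs a2 z; pose st (p : {set 'I_n} * {set 'I_n}) := setarray 1 (inset p.1) (setarray 2 (inset p.2) s).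
have sE : s = st ([set: 'I_n], set0).
  by rewrite /st -{1}(setarray_id 1 s) (base_S bs) -{1}(setarray_id 2 s) a2.
rewrite {1}sE (@run_For N _ st (fun p _ => (reduce1 p.1, mark p.1)) (fun _ => True)) //; first last.
- move=> v [S M] _ _; split=> //=; rewrite run_Seq; set t := setreg 34 v _.
  have bt : base E k S t by apply: base_setreg => //; apply: (base_setarray _ (base_setarray2 _ bs)).
  have zt l : all (mem scr_reduce) l -> 34 \notin l -> zero l t.
    by move=> h1 h2; apply: zero_setreg => //; apply: zero_sub z.
  rewrite (run_Mark bt (erefl : arr t 2 = inset M)); last exact: zt.
  have bt2 : base E k (S :&: mark S) (setarray 1 (inset (S :&: mark S)) (setarray 2 (inset (mark S)) t)).
    exact: (base_setarray _ (base_setarray2 _ bt)).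
  rewrite (run_Prune bt2); last exact: zt.
  rewrite setarrayK /st /t /= !setreg_setarray.
  rewrite /setarray /=; congr State; apply: functional_extensionality => a.
  by case: (a == 1); case: (a == 2).
- by move=> ? _; apply: z.
have -> (p : {set 'I_n} * {set 'I_n}) l : foldl (fun p _ => (reduce1 p.1, mark p.1)) p l =
    (iter (size l) reduce1 p.1, (foldl (fun p (_ : nat) => (reduce1 p.1, mark p.1)) p l).2).
  elim: l p => [|a l IH] p /=; first by case: p.
  by rewrite IH /= -iterSr.
by rewrite size_iota; eexists.
Qed.

End Reduction.

(** * Exhaustive application of the rules *)

(** A step that is not stationary loses an element, so [m] rounds reach a fixpoint as soon as [m] is
    at least the size of the set. *)
Lemma iter_deflate (T : finType) (f : {set T} -> {set T}) (X : {set T}) m :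
  (forall Y : {set T}, f Y \subset Y) -> #|X| <= m -> f (iter m f X) = iter m f X.
Proof.
move=> hf; elim: m X => [|m IH] X hX.
  by apply/eqP; rewrite eqEsubset hf (_ : X = set0) ?sub0set //; apply/eqP; rewrite -cards_eq0 -leqn0.
case: (eqVneq (f X) X) => [E|ne].
  by have -> : iter m.+1 f X = X by elim: m.+1 => //= ? ->.
by rewrite iterSr IH // -ltnS (leq_trans _ hX) // proper_card // properEneq ne hf.
Qed.

Lemma iter_inflate (T : finType) (f : {set T} -> {set T}) (X : {set T}) m :
  (forall Y : {set T}, Y \subset f Y) -> #|T| - #|X| <= m -> f (iter m f X) = iter m f X.
Proof.
move=> hf; elim: m X => [|m IH] X hX.
  have -> : X = setT by apply/eqP; rewrite eqEcard subsetT cardsT -subn_eq0 -leqn0.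
  by apply/eqP; rewrite eqEsubset subsetT hf.
case: (eqVneq (f X) X) => [E|ne].
  by have -> : iter m.+1 f X = X by elim: m.+1 => //= ? ->.
rewrite iterSr IH //.
have : #|X| < #|f X| by rewrite proper_card // properEneq eq_sym ne hf.
by have := max_card (f X); lia.
Qed.

(** Steps only move up in the order, so a fold that ends where it began never left its starting
    point. A stationary pass over all vertices thus shows that no single step applies. *)
Lemma foldl_fixed (T I : eqType) (le : rel T) (g : T -> I -> T) a s :
  reflexive le -> transitive le -> antisymmetric le -> (forall a i, le a (g a i)) ->
  foldl g a s = a -> forall i, i \in s -> g a i = a.
Proof.
move=> lr lt la hg; elim: s => //= i s IH E.
have le_foldl b : le b (foldl g b s).
  by elim: s b {IH E} => //= j s IH b; apply: lt (IH _).
have gi : g a i = a by apply: la; rewrite hg andbT -{2}E le_foldl.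
by move=> j; rewrite inE => /orP[/eqP -> //|]; apply: IH; rewrite -{2}E gi.
Qed.

Section Reduced.
Variables (n : nat) (E : rel 'I_n) (k : nat).
Hypotheses (Esym : symmetric E) (Eirr : irreflexive E).
Implicit Types S M : {set 'I_n}.
Let N := size (enc E k).
Let n_le : n <= N.
Proof. by rewrite /N size_enc; lia. Qed.

Lemma prune1_sub S v : prune1 E k S v \subset S.
Proof. by rewrite /prune1; case: ifP => // _; apply: subsetDl. Qed.

Lemma prune_sub S : prune E k S \subset S.
Proof.
rewrite /prune; elim: (enum _) S => //= v s IH S.
exact: subset_trans (IH _) (prune1_sub _ _).
Qed.

Lemma completable_prune S : completable E S k <-> completable E (prune E k S) k.
Proof.
split; first by apply: completable_sub; apply: prune_sub.
rewrite /prune; elim: (enum _) S => //= v s IH S /IH; rewrite /prune1.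
case: ifP => // /andP[vS /orP[]].
  by move=> h; apply: completable_twin.
by move=> h; apply: completable_dominated.
Qed.

Lemma prune_fixed S : prune E k S = S -> forall v, v \in S -> ~~ deletable E k S v.
Proof.
move=> fS v vS; apply/negP => dv.
have : prune1 E k S v = S.
  apply: (@foldl_fixed _ _ (fun A B : {set 'I_n} => B \subset A) _ _ _ _ _ _ _ fS) => //.
  - by move=> B A C h1 h2; apply: subset_trans h2 h1.
  - by move=> A B /andP[h1 h2]; apply/eqP; rewrite eqEsubset h1 h2.
  - exact: prune1_sub.
  - by rewrite mem_enum.
by rewrite /prune1 vS dv => /setP /(_ v); rewrite !inE eqxx vS.
Qed.

Lemma spread1_sup S i M : M \subset spread1 E S i M.
Proof.
rewrite /spread1; elim: (enum _) M => //= j s IH M.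
by apply: subset_trans (IH _); case: ifP => // _; apply: subsetUr.
Qed.

Lemma spread_sup S M : M \subset spread E S M.
Proof.
rewrite /spread; elim: (enum _) M => //= i s IH M.
exact: subset_trans (spread1_sup _ _ _) (IH _).
Qed.

Lemma subset_anti : antisymmetric (fun A B : {set 'I_n} => A \subset B).
Proof. by move=> A B h; apply/eqP; rewrite eqEsubset. Qed.

Lemma mark_closed S i j : i \in mark E k S -> j \in S -> E i j -> j \in mark E k S.
Proof.
set M := mark E k S => iM jS ij.
have fM : spread E S M = M.
  apply: iter_inflate; first exact: spread_sup.
  by rewrite card_ord; apply: leq_trans (leq_subr _ _) n_le.
have trans : transitive (fun A B : {set 'I_n} => A \subset B).
  by move=> B A C; apply: subset_trans.
have f1 : spread1 E S i M = M.
  apply: (@foldl_fixed _ _ (fun A B : {set 'I_n} => A \subset B) _ _ _ _ trans subset_anti _ fM) => //.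
    by move=> A a; apply: spread1_sup.
  by rewrite mem_enum.
have := @foldl_fixed _ _ (fun A B : {set 'I_n} => A \subset B) _ _ _ (fun _ => subxx _) trans subset_anti _ f1.
have h (A : {set 'I_n}) a : A \subset (if [&& i \in A, a \in S & E i a] then a |: A else A).
  by case: ifP => // _; apply: subsetUr.
move=> /(_ h j); rewrite mem_enum iM jS ij => /(_ isT) /= <-.
by rewrite setU11.
Qed.

Lemma mark_inv S : [/\ paws E S \subset mark E k S, mark E k S \subset S &
  forall v, v \in mark E k S -> exists2 p, p \in paws E S & connect (induced E S) v p].
Proof.
pose inv M := [/\ paws E S \subset M, M \subset S &
  forall v, v \in M -> exists2 p, p \in paws E S & connect (induced E S) v p].
rewrite -/(inv _) /mark; elim: (size _) => [|m IH].
  split=> [|| v vp]; [exact: subxx | by apply/subsetP => v; rewrite inE => /andP[] | by exists v].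
rewrite iterS; set M := iter _ _ _ in IH *; rewrite /spread.
elim: (enum _) M IH => // i s IH M hM; rewrite [foldl _ _ _]/=; apply: IH.
rewrite /spread1; elim: (enum _) M hM => // j l IH M hM; rewrite [foldl _ _ _]/=; apply: IH.
case: ifP => // /and3P[iM jS ij]; case: hM => h1 h2 h3; split.
- by apply: subset_trans h1 (subsetUr _ _).
- by rewrite subUset sub1set jS.
- move=> v; rewrite in_setU1 => /orP[/eqP ->|]; last exact: h3.
  have [p pp ip] := h3 i iM; exists p => //; apply: connect_trans (connect1 _) ip.
  by rewrite /induced jS (subsetP h2) //= Esym.
Qed.

Lemma completable_mark S : completable E S k <-> completable E (S :&: mark E k S) k.
Proof.
split; first by apply: completable_sub; apply: subsetIl.
apply: completable_closed => //; first exact: subsetIl.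
  move=> x y; rewrite !inE => /andP[_ xM] yS xy; rewrite yS.
  exact: mark_closed xM yS xy.
move=> x1 x2 x3 x4; rewrite !inE => /andP[n1 S1] /andP[_ S2] /andP[_ S3] /andP[_ S4].
apply/negP => hp; have [h _ _] := mark_inv S.
move: n1; rewrite S1 /= => /negP; apply; apply: (subsetP h); rewrite inE S1 /=.
by apply/exists_inP; exists x2 => //; apply/exists_inP; exists x3 => //; apply/exists_inP; exists x4.
Qed.

Lemma reduce1_sub S : reduce1 E k S \subset S.
Proof. exact: subset_trans (prune_sub _) (subsetIl _ _). Qed.

Lemma completable_reduced : completable E [set: 'I_n] k <-> completable E (reduced E k) k.
Proof.
rewrite /reduced; elim: (size _) => // m IH; rewrite iterS {1}/reduce1.
apply: iff_trans IH (iff_trans (completable_mark _) (completable_prune _)).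
Qed.

Lemma reduced_bound : completable E (reduced E k) k -> #|reduced E k| <= 16 * k.+1 ^ 2.
Proof.
have : reduce1 E k (reduced E k) = reduced E k.
  by apply: iter_deflate; [exact: reduce1_sub | rewrite cardsT card_ord].
set S := reduced E k => fS.
(* Marking and pruning both only shrink the set, so a stationary round makes each of them
   stationary. *)
have mS : S :&: mark E k S = S.
  by apply/eqP; rewrite eqEsubset subsetIl /= -{1}fS prune_sub.
have pS : prune E k S = S by rewrite -{2}fS /reduce1 mS.
apply: kernel_bound => //.
- move=> v vS; have vM : v \in mark E k S by move: vS; rewrite -{1}mS inE => /andP[].
  have [_ _ h] := mark_inv S; have [p pp vp] := h v vM.
  move: pp; rewrite inE => /andP[pS' /exists_inP[x2 S2 /exists_inP[x3 S3 /exists_inP[x4 S4 hp]]]].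
  by exists p, x2, x3, x4.
- by move=> v vS; have := prune_fixed pS vS; rewrite /deletable negb_or => /andP[].
- by move=> v vS; have := prune_fixed pS vS; rewrite /deletable negb_or => /andP[].
Qed.

End Reduced.

(** * Reading the instance and writing the kernel *)

Ltac state_eq := rewrite /setreg /=; congr State; apply: functional_extensionality;
  let i := fresh in move=> i; rewrite /upd /=;
  repeat match goal with |- context [i == ?c] => case: (i =P c) => [?|?]; [subst i => /=|] end.

Definition Double x z := Seq (AddTo 30 x z) (Seq (AddTo 30 z x) (Zero x)).
(** Register 9 carries the weight of the current bit of [k] and is doubled after each bit; register
    10 is its temporary copy. Bits are recognised by their position, from register 8 on. *)
Definition Init :=
  Seq (For 30 (When (Neg (Ex 31 (And (Neg (Lt 30 31)) (Neg (Bit 0 31))))) (Inc 0)))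
  (Seq (AddTo 30 1 0) (Seq (Inc 1)
  (Seq (AddTo 30 8 1) (Seq (For 31 (When (Lt 31 0) (AddTo 30 8 0)))
  (Seq (Inc 9) (Seq (For 31 (When (Neg (Lt 31 8)) (Seq (When (Bit 0 31) (AddTo 30 5 9)) (Double 10 9))))
  (Seq (AddTo 30 6 5) (Seq (AddTo 30 6 5)
  (For 30 (When (Lt 30 0) (Put 1 30 true))))))))))).

Definition EmitAll (l : seq bool) := foldr (fun b c => Seq (Emit b) c) (Ret true) l.
Definition Copy c := Ite c (Emit true) (Emit false).
Definition EmitGraph := Seq (For 30 (When (Bit 1 30) (Emit true))) (Seq (Emit false)
  (Seq (For 30 (When (Bit 1 30) (For 31 (When (Bit 1 31) (Copy (Edge 30 31))))))
       (For 30 (When (Neg (Lt 30 8)) (Copy (Bit 0 30)))))).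
Definition Size := For 30 (When (And (Bit 1 30) (Ret true)) (Inc 11)).
(** [Neg (Lt 5 30)] admits the values from 0 to that of register 5 inclusive, one more than [k], so
    the double loop adds up to 16(k + 1)^2 before saturation. *)
Definition Bound := For 30 (When (Neg (Lt 5 30)) (For 31 (When (Neg (Lt 5 31)) (iter 16 (Seq (Inc 12)) (Ret true))))).
Definition Final l := Seq Size (Seq Bound (Ite (Lt 12 11) (EmitAll l) EmitGraph)).

Lemma foldl_saturate M c y w m : w <= M ->
  foldl (fun w v => if v < y then minn (w + c) M else w) w (iota 0 m) = minn (w + minn m y * c) M.
Proof.
move=> hw; elim: m => [|m IH]; first by rewrite min0n mul0n addn0 /=; lia.
rewrite foldl_iotaS IH; case: (ltnP m y) => my.
  have -> : minn m.+1 y = m.+1 by lia.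
  by rewrite mulSn; lia.
by have -> : minn m.+1 y = y by lia.
Qed.

Lemma modn_bit k i : k %% 2 ^ i.+1 = k %% 2 ^ i + odd (k %/ 2 ^ i) * 2 ^ i.
Proof.
have p : 0 < 2 ^ i by rewrite expn_gt0.
have h := ltn_pmod k p.
set d := k %/ 2 ^ i.
have dk : k = d./2 * 2 ^ i.+1 + (odd d * 2 ^ i + k %% 2 ^ i).
  rewrite {1}(divn_eq k (2 ^ i)) -/d -{1}(odd_double_half d) mulnDl -mul2n expnS.
  by rewrite [2 * _]mulnC -mulnA; lia.
rewrite {1}dk modnMDl modn_small; first by rewrite addnC.
by rewrite expnS; case: (odd d) => /=; lia.
Qed.

(** * Decoding the input and writing the output *)

Section InitFinal.
Variables (n : nat) (E : rel 'I_n) (k : nat).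
Let inp := enc E k.
Let N := size inp.
Let q := n.+1 + n * n.
Let K := size (bin k).

Let N_eq : N = q + K. Proof. exact: size_enc. Qed.
Let K_gt0 : 0 < K. Proof. exact: size_bin_gt0. Qed.
Let q_gt : n < q. Proof. exact: leq_addr. Qed.

Let bit_at v : q <= v -> v < N -> nth false inp v = odd (k %/ 2 ^ (v - q)).
Proof.
move=> qv vN; rewrite -{1}(subnKC qv) -nth_drop (enc_bits E) /bin (nth_map 0) ?nth_iota //.
  by move: vN; rewrite N_eq /K size_map size_iota; lia.
by move: vN; rewrite size_iota N_eq /K size_map size_iota; lia.
Qed.

Let counter (p : nat * nat) v := if v < q then p else
  ((if nth false inp v then minn (p.1 + p.2) N.-1 else p.1), minn (p.2 + p.2) N.-1).

Let counter_end : (foldl counter (0, 1) (iota 0 N)).1 = minn k N.-1.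
Proof.
(* The pair holds the value of the bits read so far and the weight of the next one. Truncating both
   summands and then their sum equals truncating the true sum, so it is harmless to truncate at
   every step. *)
have G m : m <= N -> foldl counter (0, 1) (iota 0 m) =
    (minn (k %% 2 ^ (m - q)) N.-1, minn (2 ^ (m - q)) N.-1).
  elim: m => [|m IH] hm; first by rewrite /= sub0n expn0 modn1; congr pair; lia.
  rewrite foldl_iotaS IH ?(ltnW hm) // /counter; case: (ltnP m q) => mq.
    by rewrite (eqnP mq) (_ : m - q = 0) //; lia.
  rewrite bit_at // subSn // modn_bit expnS /=; congr pair; last by lia.
  by case: (odd _) => /=; lia.
rewrite G // /=; congr minn; apply: modn_small.
rewrite N_eq addKn /K size_map size_iota; exact: trunc_log_ltn.
Qed.

Let s0 := initial inp.

Lemma run_Init : exists s, run N Init s0 = s /\ [/\ base E k [set: 'I_n] s,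
  arr s 2 = inset (set0 : {set 'I_n}), out s = [::] &
  forall x, x \notin [:: 0; 1; 5; 6; 8; 9] -> reg s x = 0].
Proof.
have hq : q < N by rewrite N_eq; lia.
pose s1 := setreg 0 n s0.
have e1 : run N (For 30 (When (Neg (Ex 31 (And (Neg (Lt 30 31)) (Neg (Bit 0 31))))) (Inc 0))) s0 = s1.
  rewrite (@run_Inc_count N 30 0 _ s0 (fun a => a < n)) //; try by rewrite /=; lia.
    by rewrite count_ltn /s1; congr setreg; rewrite /=; lia.
  move=> v w hv; rewrite -(enc_prefix hv); apply/test_Neg/test_Ex => // u hu.
  by apply: test_And => [|_]; apply: test_Neg.
pose s2 := setreg 1 n.+1 s1.
have e2 : run N (Inc 1) (run N (AddTo 30 1 0) s1) = s2.
  rewrite run_AddTo //; try by rewrite /s1 /= /upd /=; lia.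
  rewrite /run /= setreg_setreg /s2; congr setreg; rewrite /s1 /= /upd /=; lia.
pose s3 := setreg 8 q s2.
have e3 : run N (For 31 (When (Lt 31 0) (AddTo 30 8 0))) (run N (AddTo 30 8 1) s2) = s3.
  have -> : run N (AddTo 30 8 1) s2 = setreg 8 n.+1 s2.
    rewrite run_AddTo //; try by rewrite /s2 /s1 /= /upd /=; lia.
    by congr setreg; rewrite /s2 /s1 /= /upd /=; lia.
  rewrite (@run_For N _ (fun w => setreg 8 w s2) (fun w v => if v < n then minn (w + n) N.-1 else w)
    (fun w => w < N)) //; first last.
  - by lia.
  - move=> v w hv hw; split; last by case: ifP; lia.
    rewrite (@run_When _ _ _ _ (v < n)); last by [].
    case: ifP => // _; rewrite run_AddTo //; try by rewrite /s2 /s1 /= /upd /=; lia.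
    by rewrite (setregC _ _ (setreg 8 w s2)) // setreg_setreg.
  by rewrite foldl_saturate; [rewrite /s3; congr setreg; rewrite /q; lia | lia].
pose st (p : nat * nat) := setreg 5 p.1 (setreg 9 p.2 s3).
pose kp := foldl counter (0, 1) (iota 0 N).
have e4 : run N (For 31 (When (Neg (Lt 31 8)) (Seq (When (Bit 0 31) (AddTo 30 5 9)) (Double 10 9))))
   (run N (Inc 9) s3) = st kp.
  have -> : run N (Inc 9) s3 = st (0, 1).
    by rewrite /run /st /s3 /s2 /s1; state_eq; lia.
  apply: (@run_For N _ st counter (fun p => p.1 < N /\ p.2 < N)) => //; last by rewrite /=; lia.
  move=> v [a b] hv [/= ha hb]; split; last first.
    by rewrite /counter; case: ifP => //= _; split; [case: ifP => _; lia | lia].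
  set t := setreg 31 v _.
  rewrite (@run_When _ _ _ _ (~~ (v < q))); last by apply: test_Neg.
  rewrite /counter; case: (ltnP v q) => //= _.
  rewrite run_Seq.
  set a' := if _ then _ else a.
  have -> : run N (When (Bit 0 31) (AddTo 30 5 9)) t = setreg 31 v (st (a', b)).
    rewrite (@run_When _ _ _ _ (nth false inp v)); last by [].
    rewrite /a'; case: ifP => // _.
    rewrite run_AddTo //; try by rewrite /t /= /upd /=; lia.
    by rewrite /t (setregC _ _ (setreg 5 a _)) // setreg_setreg.
  rewrite /Double !run_Seq.
  have -> : run N (AddTo 30 10 9) (setreg 31 v (st (a', b))) = setreg 10 b (setreg 31 v (st (a', b))).
    rewrite run_AddTo //; try by rewrite /= /upd /=; lia.
    by congr setreg; rewrite /= /upd /=; lia.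
  rewrite run_AddTo //; try by rewrite /= /upd /=; lia.
  by rewrite /run /st /s3 /s2 /s1; state_eq; lia.
have kE : kp.1 = minn k N.-1 by apply: counter_end.
pose s5 := setreg 6 (minn k.*2 N.-1) (st kp).
have e5 : run N (AddTo 30 6 5) (run N (AddTo 30 6 5) (st kp)) = s5.
  have -> : run N (AddTo 30 6 5) (st kp) = setreg 6 kp.1 (st kp).
    rewrite run_AddTo //; try by rewrite /= /upd /= ?kE; lia.
    by congr setreg; rewrite /= /upd /= kE; lia.
  rewrite run_AddTo //; try by rewrite /= /upd /= ?kE; lia.
  by rewrite setreg_setreg /s5; congr setreg; rewrite /= /upd /= kE; lia.
have i0 A : 0 < A -> arr s5 A = inset (set0 : {set 'I_n}).
  move=> A0; apply: functional_extensionality => p; rewrite /= /inset.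
  by rewrite (_ : A == 0 = false); [case: insubP => // ? _ _; rewrite in_set0 | lia].
have e6 : run N (For 30 (When (Lt 30 0) (Put 1 30 true))) s5 = setarray 1 (inset [set: 'I_n]) s5.
  rewrite -{1}(setarray_id 1 s5) i0 //.
  rewrite (@run_For_ord n E k _ (fun S => setarray 1 (inset S) s5) (fun S v => if predT v then v |: S else S)) //.
  - by rewrite (foldl_add predT); congr (setarray 1 (inset _) _); apply/setP => u; rewrite !inE mem_enum.
  - move=> v S; rewrite (@run_When _ _ _ _ true); last by rewrite /test /= /upd /= ltn_ord.
    by rewrite /run /= /upd eqxx setreg_setarray setarr_setarray inset_add.
  - move=> v S hv; rewrite (@run_When _ _ _ _ false) //.
    by rewrite /test /= /upd /= ltnNge hv.
exists (setarray 1 (inset [set: 'I_n]) s5); split.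
  by rewrite /Init !run_Seq e1 e2 e3 e4 e5 e6.
split; last 2 first.
- by [].
- by move=> x; rewrite !inE !negb_or => /and5P[x0 x1 x5 x6 /andP[x8 x9]];
  rewrite /= /upd (negbTE x0) (negbTE x1) (negbTE x5) (negbTE x6) (negbTE x8) (negbTE x9).
- by split; rewrite //= /upd.
- by rewrite -(i0 2).
Qed.

Lemma run_EmitAll l s : run N (EmitAll l) s = State (reg s) (arr s) (out s ++ l).
Proof.
elim: l s => [|b l IH] s /=; first by rewrite cats0; case: s.
by rewrite run_Seq IH /= cat_rcons.
Qed.

Lemma run_Copy c s b : test N c s b -> run N (Copy c) s = emit b s.
Proof. by move=> h; rewrite (run_Ite _ _ h); case: b {h}. Qed.

Let st s o := State (reg s) (arr s) o.

Lemma run_For_emit s x c (f : 'I_n -> seq bool) : reg s x = 0 ->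
  (forall (v : 'I_n) o, run N c (setreg x v (st s o)) = setreg x v (st s (o ++ f v))) ->
  (forall v o, n <= v -> run N c (setreg x v (st s o)) = setreg x v (st s o)) ->
  run N (For x c) s = st s (out s ++ flatten [seq f v | v <- enum 'I_n]).
Proof.
move=> hx h1 h2.
have {1}-> : s = st s (out s) by rewrite /st; case: (s).
rewrite (@run_For_ord n E k _ (st s) (fun o v => o ++ f v)) //.
congr (st s); elim: (enum _) (out s) => [|v l IH] o /=; first by rewrite cats0.
by rewrite IH catA.
Qed.

Lemma flatten_enum A (S : {set 'I_n}) (f : 'I_n -> seq A) :
  flatten [seq (if v \in S then f v else [::]) | v <- enum 'I_n] = flatten [seq f v | v <- enum S].
Proof.
rewrite {2}/enum_mem -enumT; elim: (enum 'I_n) => //= v l IH.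
by rewrite IH; case: ifP.
Qed.

Lemma flatten_seq1 A (f : 'I_n -> A) l : flatten [seq [:: f v] | v <- l] = [seq f v | v <- l].
Proof. by elim: l => //= v l ->. Qed.

Definition subgraph_code (S : {set 'I_n}) :=
  nseq #|S| true ++ false :: [seq E i j | i <- enum S, j <- enum S] ++ bin k.

Lemma run_EmitGraph S s : base E k S s -> zero (30 :: 31 :: scratch) s -> out s = [::] ->
  out (run N EmitGraph s) = subgraph_code S.
Proof.
move=> bs z os; rewrite /EmitGraph !run_Seq.
have b1 o : base E k S (st s o) by apply: base_out.
have e1 : run N (For 30 (When (Bit 1 30) (Emit true))) s = st s (nseq #|S| true).
  rewrite (run_For_emit (f := fun v => if v \in S then [:: true] else [::])); first last.
  - move=> v o hv; rewrite (@run_When _ _ _ _ false) //.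
    by rewrite /test /= (base_S bs) /upd eqxx inset_ge.
  - move=> v o; rewrite (@run_When _ _ _ _ (v \in S)); last first.
      by apply: (@test_Bit1 n E k S) => //; apply: base_setreg.
    by case: ifP => _; rewrite ?cats0 // /run /= /emit /= cats1.
  - by apply: z.
  rewrite os flatten_enum flatten_seq1 cardE /=; congr st.
  by elim: (enum _) => //= v l ->.
rewrite e1; set s2 := run N (Emit false) _.
have -> : s2 = st s (nseq #|S| true ++ [:: false]) by rewrite cats1.
set o2 := _ ++ _.
have e2 : run N (For 30 (When (Bit 1 30) (For 31 (When (Bit 1 31) (Copy (Edge 30 31)))))) (st s o2) =
    st s (o2 ++ [seq E i j | i <- enum S, j <- enum S]).
  rewrite (@run_For_emit (st s o2) _ _ (fun v => if v \in S then [seq E v j | j <- enum S] else [::])); first last.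
  - move=> v o hv; rewrite (@run_When _ _ _ _ false) //.
    by rewrite /test /= (base_S bs) /upd eqxx inset_ge.
  - move=> v o; rewrite (@run_When _ _ _ _ (v \in S)); last first.
      by apply: (@test_Bit1 n E k S) => //; apply: base_setreg => //; apply: b1.
    case: ifP => _; last by rewrite cats0.
    rewrite (@run_For_emit (setreg 30 v (st (st s o2) o)) _ _ (fun u => if u \in S then [:: E v u] else [::])).
    + by rewrite flatten_enum flatten_seq1.
    + by rewrite reg_setreg; apply: z.
    + move=> u o'; set t := setreg 31 u _.
      have bt : base E k S t by apply: base_setreg => //; apply: base_out; apply: base_setreg => //; apply: b1.
      rewrite (@run_When _ _ _ _ (u \in S)); last exact: (test_Bit1 bt).
      case: ifP => _; last by rewrite cats0.
      rewrite (run_Copy (b := E v u)); first by rewrite /emit /= cats1.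
      apply: (@test_Edge n E k S) => //; apply: zero_setreg => //.
      by apply: (@zero_setreg scratch 30 v (st s o)) => //; apply: zero_sub z.
    + move=> u o' hu; rewrite (@run_When _ _ _ _ false) //.
      by rewrite /test /= (base_S bs) /upd eqxx inset_ge.
  - by apply: z.
  by rewrite flatten_enum.
rewrite e2; set o3 := _ ++ [seq _ | _ <- _, _ <- _].
have e3 : run N (For 30 (When (Neg (Lt 30 8)) (Copy (Bit 0 30)))) (st s o3) = st s (o3 ++ bin k).
  rewrite (@run_For N _ (st s) (fun o v => if v < q then o else rcons o (nth false inp v)) (fun _ => True)) //; first last.
  - move=> v o hv _; split=> //; rewrite (@run_When _ _ _ _ (~~ (v < q))); last first.
      by rewrite /test /= /upd /= (base_q bs) -/q; case: ifP.
    rewrite (@run_Copy _ _ (nth false inp v)); last by rewrite /test /= /upd eqxx (base_inp bs).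
    by case: (ltnP v q).
  - by move=> ? _; apply: z.
  congr (st s); rewrite -(enc_bits E k) -/q -/inp -/N.
  suff G m : q + m <= N -> foldl (fun o v => if v < q then o else rcons o (nth false inp v)) o3 (iota 0 (q + m)) =
      o3 ++ take m (drop q inp).
    rewrite N_eq G ?N_eq // take_oversize // size_drop -/N N_eq; lia.
  elim: m => [|m IH] hm.
    rewrite take0 cats0 addn0; have : forall v, v \in iota 0 q -> v < q by move=> v; rewrite mem_iota.
    elim: (iota 0 q) => //= v l IHl hl; rewrite hl ?mem_head // IHl // => u ul.
    by apply: hl; rewrite inE ul orbT.
  rewrite addnS foldl_iotaS IH; last by lia.
  rewrite ifF; last by lia.
  by rewrite (take_nth false) ?size_drop ?rcons_cat ?nth_drop // -/N; lia.
by rewrite e3 /= /o3 /o2 /subgraph_code -!catA.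
Qed.

Lemma run_Final S s l : base E k S s -> zero (11 :: 12 :: 30 :: 31 :: scratch) s -> out s = [::] ->
  out (run N (Final l) s) = if minn (16 * k.+1 ^ 2) N.-1 < #|S| then l else subgraph_code S.
Proof.
move=> bs z os; rewrite /Final !run_Seq.
have nN : n.+1 < N by rewrite N_eq; lia.
have SN : #|S| <= n by apply: leq_trans (max_card _) _; rewrite card_ord.
have -> : run N Size s = setreg 11 #|S| s.
  rewrite /Size (run_CountS (S := S) (q := predT)) //; try by apply: z.
  by congr setreg; apply: eq_card => u; rewrite !inE andbT.
set s1 := setreg 11 _ s.
have z1 : zero (12 :: 30 :: 31 :: scratch) s1 by apply: zero_setreg => //; apply: zero_sub z.
have b1 : base E k S s1 by apply: base_setreg.
pose m := minn k N.-1.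
have inc c w t : reg t 12 = w -> w < N -> run N (iter c (Seq (Inc 12)) (Ret true)) t = setreg 12 (minn (w + c) N.-1) t.
  elim: c w t => [|c IH] w t tw wN.
    by rewrite setreg_same // tw; lia.
  rewrite iterS run_Seq (IH (minn w.+1 N.-1)); last by lia.
    by rewrite setreg_setreg; congr setreg; lia.
  by rewrite /= /upd /= tw.
have inner w t : base E k S t -> reg t 31 = 0 -> w < N ->
    run N (For 31 (When (Neg (Lt 5 31)) (iter 16 (Seq (Inc 12)) (Ret true)))) (setreg 12 w t) =
    setreg 12 (minn (w + m.+1 * 16) N.-1) t.
  move=> bt t31 wN.
  rewrite (@run_For N _ (fun w => setreg 12 w t) (fun w v => if v < m.+1 then minn (w + 16) N.-1 else w)
    (fun w => w < N)) //; first last.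
  - move=> v u hv hu; split; last by case: ifP; lia.
    rewrite (@run_When _ _ _ _ (~~ (m < v))); last by rewrite /test /= /upd /= (base_k bt); case: ifP.
    rewrite -leqNgt -ltnS; case: ifP => // _; rewrite (inc _ u) //.
    by rewrite (setregC _ _ (setreg 12 u t)) // setreg_setreg.
  rewrite foldl_saturate; last by lia.
  by have -> : minn N m.+1 = m.+1 by rewrite /m; lia.
have -> : run N Bound s1 = setreg 12 (minn (m.+1 * (m.+1 * 16)) N.-1) s1.
  rewrite -{1}(setreg_same (z1 12 isT)).
  rewrite /Bound (@run_For N _ (fun w => setreg 12 w s1) (fun w v => if v < m.+1 then minn (w + m.+1 * 16) N.-1 else w)
    (fun w => w < N)) //; first last.
  - by lia.
  - move=> v u hv hu; split; last by case: ifP; lia.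
    rewrite (@run_When _ _ _ _ (~~ (m < v))); last by rewrite /test /= /upd /= (base_k bs); case: ifP.
    rewrite -leqNgt -ltnS; case: ifP => // _.
    rewrite setregC // inner //; first by rewrite setregC.
    + exact: base_setreg.
    + by rewrite reg_setreg; apply: z1.
  - by move=> w _; apply: z1.
  rewrite foldl_saturate; last by lia.
  by have -> : minn N m.+1 = m.+1 by rewrite /m; lia.
set s2 := setreg 12 _ s1.
have b2 : base E k S s2 by apply: base_setreg.
(* The program has only the truncated value [m] of [k]. If [k] exceeds [N.-1], both products reach
   [N.-1] and the two minima coincide. *)
have E2 : (minn (m.+1 * (m.+1 * 16)) N.-1 < #|S|) = (minn (16 * k.+1 ^ 2) N.-1 < #|S|).
  case: (leqP k N.-1) => hk.
    have -> : m = k by rewrite /m; lia.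
    by have -> : k.+1 * (k.+1 * 16) = 16 * k.+1 ^ 2 by rewrite -mulnn; lia.
  have h : N.-1 <= k.+1 ^ 2 by rewrite -mulnn; nia.
  have mE : m = N.-1 by rewrite /m; lia.
  by rewrite mE; apply/idP/idP; nia.
rewrite (@run_Ite _ _ _ _ _ (minn (16 * k.+1 ^ 2) N.-1 < #|S|)); last first.
  by rewrite -E2 /test /= /upd.
case: ifP => _; first by rewrite run_EmitAll /= os.
apply: run_EmitGraph => //.
by apply: zero_setreg => //; apply: zero_sub z1.
Qed.

End InitFinal.

(** * The kernel *)

Section Transfer.

Lemma card_fill n (E H : rel 'I_n) : symmetric E -> symmetric H -> irreflexive H ->
  #|fill E H [set: 'I_n]| =
  #|[set p : 'I_n * 'I_n | [&& (p.1 < p.2)%N, H p.1 p.2 & ~~ E p.1 p.2]]|.*2.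
Proof.
move=> Es Hs Hi; set U := [set p | _]; set f := fun p : 'I_n * 'I_n => (p.2, p.1).
have fI : injective f by move=> [a b] [c d] [-> ->].
have -> : fill E H [set: 'I_n] = U :|: f @: U.
  apply/setP => -[x y]; rewrite !inE /=.
  have -> : ((x, y) \in f @: U) = ((y, x) \in U) by rewrite -(mem_imset U _ fI).
  rewrite !inE /= [H y x]Hs [E y x]Es -andb_orl; case: (ltngtP x y) => //= /val_inj ->.
  by rewrite Hi.
rewrite cardsU card_imset // (_ : U :&: _ = set0) ?cards0 ?subn0 ?addnn //.
apply/setP => -[x y]; rewrite inE.
have -> : ((x, y) \in f @: U) = ((y, x) \in U) by rewrite -(mem_imset U _ fI).
by rewrite !inE /=; case: ltngtP; rewrite ?andbF.
Qed.

Lemma pfea_completable n (E : rel 'I_n) k : simple_graph E ->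
  pfea E k <-> completable E [set: 'I_n] k.
Proof.
move=> [Es Ei]; split=> [[H [[Hs Hi] sub pf c]]|[H [Hs Hi sub pf c]]]; exists H.
- split=> //; [by move=> x y _ _; apply: sub | | by rewrite card_fill // leq_double].
  move=> x1 x2 x3 x4 _ _ _ _; apply/negP => hp.
  have /pf : uniq [:: x1; x2; x3; x4].
    case/and5P: hp => e12 e23 e13 e34 /andP[n14 n24].
    have ne a b : H a b -> a != b by apply: contraTneq => ->; rewrite Hi.
    rewrite /= !inE !negb_or (ne _ _ e12) (ne _ _ e13) (ne _ _ e23) (ne _ _ e34) !andbT /=.
    apply/andP; split.
      by apply: contraNneq n24 => <-; rewrite Hs.
    by apply: contraNneq n14 => <-.
  by rewrite -/(paw H x1 x2 x3 x4) hp.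
- split=> //; first by move=> x y; apply: sub; rewrite inE.
    by move=> x1 x2 x3 x4 _; apply: pf; rewrite inE.
  by rewrite -leq_double -card_fill.
Qed.

Lemma completable_imset (V W : finType) (f : W -> V) (E : rel V) (S : {set V}) k : injective f ->
  S = f @: [set: W] -> completable E S k <-> completable (fun i j => E (f i) (f j)) [set: W] k.
Proof.
move=> fI SE; pose ff (p : W * W) := (f p.1, f p.2).
have ffI : injective ff by move=> [a b] [c d] [/fI -> /fI ->].
have inS i : f i \in S by rewrite SE imset_f.
split=> [[H [h1 h2 h3 h4 h5]]|[H [h1 h2 h3 h4 h5]]].
  exists (fun i j => H (f i) (f j)); split.
  - by move=> x y; rewrite h1.
  - by move=> x; rewrite h2.
  - by move=> x y _ _; apply: h3.
  - by move=> x1 x2 x3 x4 _ _ _ _; apply: h4.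
  - rewrite -(card_imset _ ffI); apply: leq_trans h5; apply: subset_leq_card.
    apply/subsetP => _ /imsetP[[x y] hp ->]; move: hp; rewrite !inE /= => /andP[-> ->].
    by rewrite !inS.
(* The image of [H] under [f], without edges outside the range of [f]; this keeps it symmetric and
   irreflexive on all of [V]. *)
pose H' x y := [exists i, exists j, [&& f i == x, f j == y & H i j]].
have HE i j : H' (f i) (f j) = H i j.
  apply/existsP/idP => [[a /existsP[b /and3P[/eqP/fI -> /eqP/fI ->]]] //|h].
  by exists i; apply/existsP; exists j; rewrite !eqxx.
have SP x : x \in S -> exists i, x = f i by rewrite SE => /imsetP[i _ ->]; exists i.
exists H'; split.
- move=> x y; apply/existsP/existsP => -[a /existsP[b /and3P[ha hb hab]]];
  by exists b; apply/existsP; exists a; rewrite ha hb h1.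
- by move=> x; apply/existsP => -[a /existsP[b /and3P[/eqP <- /eqP/fI ->]]]; rewrite h2.
- by move=> x y /SP[i ->] /SP[j ->]; rewrite HE; apply: h3; rewrite inE.
- move=> x1 x2 x3 x4 /SP[i1 ->] /SP[i2 ->] /SP[i3 ->] /SP[i4 ->].
  by have := h4 i1 i2 i3 i4; rewrite /paw !HE !inE; apply.
- rewrite -(card_imset _ ffI) in h5; apply: leq_trans h5; apply: subset_leq_card.
  apply/subsetP => -[x y]; rewrite !inE /= => /and4P[/SP[i ->] /SP[j ->]]; rewrite HE => hij nE.
  by apply/imsetP; exists (i, j); rewrite // !inE /= hij nE.
Qed.

(** The program lists the surviving vertices in the order of [enum S]. Because [enum_val] follows
    the same order, the emitted matrix is literally that of the relabelled graph. *)
Lemma enum_val_enum (T : finType) (S : {set T}) : enum S = [seq enum_val i | i <- enum 'I_#|S|].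
Proof.
case: (set_0Vmem S) => [->|[x xS]].
  by rewrite enum_set0; apply/esym/size0nil; rewrite size_map size_enum_ord cards0.
apply: (@eq_from_nth _ x); first by rewrite size_map size_enum_ord cardE.
move=> i; rewrite -cardE => hi; rewrite (nth_map (Ordinal hi)) ?size_enum_ord //.
by rewrite (enum_val_nth x) nth_enum_ord.
Qed.

Definition subgraph n (E : rel 'I_n) (S : {set 'I_n}) : rel 'I_#|S| :=
  fun i j => E (enum_val i) (enum_val j).

Lemma subgraph_simple n (E : rel 'I_n) (S : {set 'I_n}) :
  simple_graph E -> simple_graph (subgraph E (S := S)).
Proof. by move=> [Es Ei]; split=> [x y|x]; [apply: Es | apply: Ei]. Qed.

Lemma completable_subgraph n (E : rel 'I_n) k (S : {set 'I_n}) : simple_graph E ->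
  completable E S k <-> pfea (subgraph E (S := S)) k.
Proof.
move=> sE; apply: iff_trans (iff_sym (pfea_completable k (subgraph_simple S sE))).
apply: completable_imset; first exact: enum_val_inj.
apply/setP => x; apply/idP/imsetP => [xS|[i _ ->]]; last exact: enum_valP.
by exists (enum_rank_in xS x); rewrite ?enum_rankK_in.
Qed.

Lemma subgraph_codeE n (E : rel 'I_n) k S : subgraph_code E k S = enc (subgraph E (S := S)) k.
Proof.
by rewrite /subgraph_code /enc enum_val_enum allpairs_mapl allpairs_mapr.
Qed.

End Transfer.

(** * The constant no-instance and the final assembly *)

Definition paw_graph : rel 'I_4 := fun i j =>
  ((i : nat), (j : nat)) \in [:: (0, 1); (1, 0); (1, 2); (2, 1); (0, 2); (2, 0); (2, 3); (3, 2)].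

Lemma paw_graph_simple : simple_graph paw_graph.
Proof.
by split=> [[[|[|[|[|]]]]] // hx [[|[|[|[|]]]] // hy]|[[|[|[|[|]]]] // hx]].
Qed.

Lemma paw_graph_no : ~ pfea paw_graph 0.
Proof.
move/(pfea_completable 0 paw_graph_simple) => [H [Hs Hi sub pf]].
rewrite leqn0 cards_eq0 => /eqP f0.
have HE i j : H i j = paw_graph i j.
  apply/idP/idP => [h|]; last by apply: sub; rewrite inE.
  apply/negPn/negP => nE; have := in_set0 (i, j); rewrite -f0 !inE /= h nE.
  by [].
have := pf (inord 0) (inord 1) (inord 2) (inord 3).
by rewrite /paw !HE /paw_graph !inordK // !inE => /(_ isT isT isT isT).
Qed.

Lemma wfc_EmitAll RG AK l : wfc RG AK (EmitAll l).
Proof. by elim: l. Qed.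

Lemma wfc_program l : wfc 50 3 (Seq Init (Seq Reduce (Final l))).
Proof. by rewrite /= wfc_EmitAll. Qed.

Definition kernel_program := Seq Init (Seq Reduce (Final (enc paw_graph 0))).

Lemma run_kernel_program n (E : rel 'I_n) k : simple_graph E ->
  out (sem (size (enc E k)) kernel_program (initial (enc E k))).2 =
  if minn (16 * k.+1 ^ 2) (size (enc E k)).-1 < #|reduced E k| then enc paw_graph 0
  else subgraph_code E k (reduced E k).
Proof.
move=> [Es Ei]; rewrite -/(run _ _ _) /kernel_program (run_Seq _ Init) (run_Seq _ Reduce).
have [s [-> [bs a2 os zs]]] := run_Init E k.
have z l : all (fun x => x \notin [:: 0; 1; 5; 6; 8; 9]) l -> zero l s.
  by move=> /allP h x /h; apply: zs.
have [M ->] := run_Reduce bs a2 (z scr_reduce isT).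
set S := reduced E k.
have b2 : base E k S (setarray 1 (inset S) (setarray 2 (inset M) s)).
  exact: (base_setarray _ (base_setarray2 _ bs)).
by apply: run_Final => //; apply: zero_setarray; apply: zero_setarray; apply: z.
Qed.

Theorem theorem4 :
  exists (M : TM) (c d C : nat),
    forall n (E : rel 'I_n) (k : nat), simple_graph E ->
      exists n' (E' : rel 'I_n') (k' : nat),
        [/\ simple_graph E', k' <= k, n' <= C * k.+1 ^ 3,
            (pfea E k <-> pfea E' k') &
            tm_computes_within M (enc E k) (c * size (enc E k) ^ d + c) (enc E' k')].
Proof.
(* The program uses registers up to 34 and arrays 0 to 2, within the 50 and 3 provided. *)
have [K [d H]] := @program_polytime 50 3 kernel_program isT isT (wfc_program _).
exists (machine (cprogram 50 3 kernel_program)), K, d, 16 => n E k sE; have [Es Ei] := sE.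
have N_gt : n.+1 < size (enc E k) by rewrite size_enc; have := size_bin_gt0 k; lia.
have := H _ (leq_ltn_trans (leq0n _) N_gt); rewrite run_kernel_program //; set S := reduced E k.
have Sn : #|S| <= n by apply: leq_trans (max_card _) _; rewrite card_ord.
have kk : k.+1 ^ 2 <= k.+1 ^ 3 by apply: leq_pexp2l.
have eqS : pfea E k <-> completable E S k.
  exact: iff_trans (pfea_completable k sE) (completable_reduced k Es Ei).
case: ltnP => hS Hout.
  exists 4, paw_graph, 0; split.
  - exact: paw_graph_simple.
  - exact: leq0n.
  - have : 0 < k.+1 ^ 3 by rewrite expn_gt0.
    by lia.
  - split=> [/eqS/(reduced_bound Es)|/paw_graph_no //].
    (* As [#|S| <= n] and [n] is below the input length minus one, exceeding the truncated bound
       means exceeding the true one. *)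
    by rewrite -/S; lia.
  - by apply: Hout; rewrite !size_enc (_ : size (bin 0) = 1) //; lia.
exists #|S|, (subgraph E (S := S)), k; split.
- exact: subgraph_simple.
- exact: leqnn.
- by apply: leq_trans hS _; lia.
- exact: iff_trans eqS (completable_subgraph k S sE).
(* At most [n] vertices and the same [k] give an output no longer than the input. *)
- rewrite -subgraph_codeE; apply: Hout; rewrite subgraph_codeE !size_enc.
  by have := leq_mul Sn Sn; lia.
Qed.
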